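(* Let $M$ be a connected matroid of rank $2$ on $n$ elements. Then \[ \operatorname{ehr}(\mathscr{P}(T_{2,n}),t)\ \preceq\ \operatorname{ehr}(\mathscr{P}(M),t)\ \preceq\ \operatorname{ehr}(\mathscr{P}(U_{2,n}),t). \] Moreover, if $M$ is neither minimal (isomorphic to $T_{2,n}$) nor uniform (equal to $U_{2,n}$), then both inequalities are strict on the coefficients of positive degree, i.e. for each $1\le j\le n-1$ the coefficient of $t^j$ in $\operatorname{ehr}(\mathscr{P}(M),t)$ is strictly larger than that in $\operatorname{ehr}(\mathscr{P}(T_{2,n}),t)$ and strictly smaller than that in $\operatorname{ehr}(\mathscr{P}(U_{2,n}),t)$. In particular, the matroid base polytope $\mathscr{P}(N)$ of every matroid $N$ of rank $2$ (connected or not) is Ehrhart positive.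
   Context: For a matroid $M$ on $\{1,\ldots,n\}$ with set of bases $\mathscr{B}$, the matroid (base) polytope is $\mathscr{P}(M)=\operatorname{conv}\{e_B : B\in\mathscr{B}\}\subseteq\mathbb{R}^n$, where $e_B=\sum_{i\in B}e_i$. For a lattice polytope $\mathscr{P}\subseteq\mathbb{R}^n$ of dimension $d$, its Ehrhart polynomial $\operatorname{ehr}(\mathscr{P},t)$ is the polynomial (of degree $d$) in $t$ with $\operatorname{ehr}(\mathscr{P},t)=\#(t\mathscr{P}\cap\mathbb{Z}^n)$ for all integers $t\geq 0$. The polytope $\mathscr{P}$ is Ehrhart positive if all coefficients (of $t^0,\ldots,t^d$) of $\operatorname{ehr}(\mathscr{P},t)$ are positive. For $p,q\in\mathbb{R}[t]$, $p(t)\preceq q(t)$ means that $q(t)-p(t)$ has only nonnegative coefficients. A matroid is connected if it is not a direct sum of matroids on smaller ground sets. $U_{2,n}$ is the uniform matroid of rank $2$ on $\{1,\ldots,n\}$, whose bases are all $2$-subsets. $T_{2,n}$ is the minimal matroid of rank $2$ on $\{1,\ldots,n\}$: its bases are $\{1,2\}$ together with all sets $\{i,j\}$ with $i\in\{1,2\}$ and $j\in\{3,\ldots,n\}$. *)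

(* Defs.v *)
From mathcomp Require Import all_boot all_order all_algebra all_fingroup.
From mathcomp Require Import boolp classical_sets cardinality reals.

Set Implicit Arguments.
Unset Strict Implicit.
Unset Printing Implicit Defensive.

Import Order.TTheory GRing.Theory Num.Theory.
Local Open Scope ring_scope.

Definition is_matroid (T : finType) (E : {set T}) (Bs : {set {set T}}) : Prop :=
  [/\ Bs != finset.set0,
      forall B, B \in Bs -> B \subset E &
      forall A B a, A \in Bs -> B \in Bs -> a \in A :\: B ->
        exists2 b, b \in B :\: A & b |: (A :\ a) \in Bs].

Record matroid (T : finType) (E : {set T}) := Matroid {
  bases :> {set {set T}};
  matroidP : is_matroid E bases }.

Definition matroid_rank (T : finType) (E : {set T}) (M : matroid E) : nat :=
  \max_(B in bases M) #|B|.

Definition direct_sum (T : finType) (Bs1 Bs2 : {set {set T}}) : {set {set T}} :=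
  [set B1 :|: B2 | B1 in Bs1, B2 in Bs2]%SET.

(* Both summands live on proper subsets of E. *)
Definition connected_matroid (T : finType) (E : {set T}) (M : matroid E) : Prop :=
  ~ exists (S1 S2 : {set T}) (M1 : matroid S1) (M2 : matroid S2),
      [/\ S1 :|: S2 = E, [disjoint S1 & S2], S1 \proper E, S2 \proper E &
          bases M = direct_sum M1 M2].

(* The element i of {1, ..., n} is the ordinal with value i - 1. *)
Definition U2 (n : nat) : {set {set 'I_n}} := [set B : {set 'I_n} | #|B| == 2]%SET.

Definition T2 (n : nat) : {set {set 'I_n}} :=
  ([set i : 'I_n | (i < 2)%N]
   |: [set [set i; j] | i in [set i : 'I_n | (i < 2)%N],
                        j in [set j : 'I_n | (2 <= j)%N]])%SET.

(* [Bs1] and [Bs2] differ by a relabelling of the ground set. *)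
Definition isomorphic (T : finType) (Bs1 Bs2 : {set {set T}}) : Prop :=
  exists s : {perm T}, [set s @: (B : {set T}) | B in Bs1]%SET = Bs2.

Section Polytopes.
Variables (R : realType) (n : nat).
Local Open Scope classical_set_scope.
Local Open Scope card_scope.

Definition conv (A : set 'rV[R]_n) : set 'rV[R]_n :=
  [set x | exists (k : nat) (w : 'I_k -> R) (v : 'I_k -> 'rV[R]_n),
     [/\ forall i, A (v i), forall i, 0 <= w i,
         \sum_i w i = 1 & x = \sum_i w i *: v i]].

Definition indicator (B : {set 'I_n}) : 'rV[R]_n :=
  \sum_(i in B) delta_mx 0 i.

Definition base_polytope (Bs : {set {set 'I_n}}) : set 'rV[R]_n :=
  conv [set indicator B | B in [set` Bs]].

Definition dilate (t : nat) (P : set 'rV[R]_n) : set 'rV[R]_n :=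
  [set t%:R *: x | x in P].

Definition lattice_points (P : set 'rV[R]_n) : set 'rV[int]_n :=
  [set z | P (map_mx intr z)].

Definition is_ehrhart (P : set 'rV[R]_n) (p : {poly R}) : Prop :=
  forall t : nat, exists2 k : nat,
    lattice_points (dilate t P) #= `I_k & p.[t%:R] = k%:R.

(* The polynomial satisfying [is_ehrhart P], which is unique when it exists
   ([is_ehrhart_inj]); 0 when there is none, which never happens for a
   lattice polytope. *)
Definition ehr (P : set 'rV[R]_n) : {poly R} := xget 0 [set p | is_ehrhart P p].

(* The largest k such that P contains k + 1 affinely independent points. *)
Definition affine_dim (P : set 'rV[R]_n) : nat :=
  \max_(k < n.+1 | `[< exists (x : 'rV[R]_n) (y : 'I_k -> 'rV[R]_n),
     [/\ P x, forall i, P (y i) & row_free (\matrix_i (y i - x))] >]) k.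

Definition ehrhart_positive (P : set 'rV[R]_n) : Prop :=
  forall i : nat, (i <= affine_dim P)%N -> 0 < (ehr P)`_i.

End Polytopes.

Arguments base_polytope R {n} Bs.

Definition coef_le (R : realType) (p q : {poly R}) : Prop :=
  forall i : nat, 0 <= (q - p)`_i.

Lemma is_ehrhart_inj (R : realType) (n : nat) (P : set 'rV[R]_n)
  (p q : {poly R}) : is_ehrhart P p -> is_ehrhart P q -> p = q.
Proof.
move=> hp hq; apply/eqP; rewrite -subr_eq0; apply/negPn/negP => nz.
have root_nat (t : nat) : root (p - q) t%:R.
  have [k hk pk] := hp t; have [l hl ql] := hq t.
  rewrite rootE hornerD hornerN pk ql subr_eq0 eqr_nat.
  by apply/eqP/card_eq_II; rewrite -(card_eql hk).
have /(max_poly_roots nz) : all (root (p - q))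
    [seq t%:R | t <- iota 0 (size (p - q)).+1].
  by apply/allP => _ /mapP[t _ ->].
rewrite map_inj_uniq ?iota_uniq; last first.
  by move=> a b /eqP; rewrite eqr_nat => /eqP.
by rewrite size_map size_iota ltnNge leqnSn => /(_ isT).
Qed.

Section RankTwo.
Variable n : nat.
Implicit Types (a b c i j : 'I_n) (A B : {set 'I_n}).

Let card2P A a : #|A| = 2%N -> a \in A ->
  exists2 c, c != a & A :\ a = [set c]%SET.
Proof.
move=> cA aA; have /cards1P[c Ec] : #|A :\ a| == 1%N.
  by have := cardsD1 a A; rewrite aA cA add1n => -[<-].
exists c => //; have : c \in A :\ a by rewrite Ec inE.
by rewrite !inE => /andP[].
Qed.

Lemma U2_is_matroid : (2 <= n)%N -> is_matroid [set: 'I_n]%SET (U2 n).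
Proof.
move=> n2; split => [|B _|A B a]; last 1 first.
- rewrite !inE => /eqP cA /eqP cB /andP[aB aA].
  have [c ca Ec] := card2P cA aA.
  have /fintype.subsetPn[b bB bA] : ~~ (B \subset A).
    apply/negP => BA; have : B == A by rewrite eqEcard BA cA cB.
    by move=> /eqP BE; rewrite BE aA in aB.
  exists b; first by rewrite !inE bA bB.
  have bc : b != c.
    apply: contraNneq bA => ->.
    by have : c \in A :\ a by [rewrite Ec inE]; rewrite !inE => /andP[].
  by rewrite Ec inE cards2 bc.
- apply/set0Pn; exists [set Ordinal (ltnW n2); Ordinal n2]%SET.
  by rewrite inE cards2.
- exact: finset.subsetT.
Qed.

Lemma in_T2 B : (2 <= n)%N ->
  (B \in T2 n) = (#|B| == 2%N) && [exists i in B, (i < 2)%N].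
Proof.
move=> n2; pose o0 : 'I_n := Ordinal (ltnW n2); pose o1 : 'I_n := Ordinal n2.
have E01 : [set i : 'I_n | (i < 2)%N]%SET = [set o0; o1]%SET.
  by apply/setP => i; rewrite !inE -!val_eqE /=; case: (val i) => [|[|]].
apply/idP/andP => [|[/eqP cB /existsP[i /andP[iB i2]]]].
  rewrite !inE => /orP[/eqP ->|/imset2P[i j]].
    rewrite E01 cards2; split => //; apply/existsP; exists o0.
    by rewrite !inE eqxx.
  rewrite !inE => i2 j2 ->; rewrite cards2; split.
    suff -> : i != j by [].
    by apply: contraTneq i2 => ->; rewrite -leqNgt.
  by apply/existsP; exists i; rewrite !inE eqxx.
have [c ci Ec] := card2P cB iB.
have EB : B = [set i; c]%SET by rewrite -(finset.setD1K iB) Ec.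
have [c2|c2] := ltnP c 2; last first.
  by rewrite !inE; apply/orP; right; apply/imset2P; exists i c; rewrite ?inE.
rewrite !inE; apply/orP; left; rewrite eq_sym eqEcard E01 cards2 cB andbT.
rewrite -E01; apply/fintype.subsetP => x; rewrite EB !inE => x2.
move: ci i2 c2 x2; rewrite -!val_eqE /=.
by case: (val i) => [|[|]] //; case: (val c) => [|[|]] //;
   case: (val x) => [|[|]].
Qed.

Lemma T2_is_matroid : (2 <= n)%N -> is_matroid [set: 'I_n]%SET (T2 n).
Proof.
move=> n2; split => [|B _|A B a]; last 1 first.
- rewrite !in_T2 // => /andP[/eqP cA /existsP[i /andP[iA i2]]].
  move=> /andP[/eqP cB /existsP[k /andP[kB k2]]].
  rewrite inE => /andP[aB aA]; have [c ca Ec] := card2P cA aA.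
  have cA' : c \in A.
    by have : c \in A :\ a by [rewrite Ec inE]; rewrite !inE => /andP[].
  have EA x : (x \in A) = (x == a) || (x == c).
    by rewrite -(finset.setD1K aA) Ec !inE.
  suff [b bB [bA bc2]] : exists2 b, b \in B & b \notin A /\ ((b < 2) || (c < 2))%N.
    exists b; first by rewrite inE bA.
    have bc : b != c by apply: contraNneq bA => ->.
    rewrite in_T2 // Ec cards2 bc /=; apply/existsP.
    by case/orP: bc2 => ?; [exists b|exists c]; rewrite !inE eqxx ?orbT.
  have [c2|c2] := ltnP c 2.
    have /fintype.subsetPn[b bB bA] : ~~ (B \subset A).
      apply/negP => BA; have : B == A by rewrite eqEcard BA cA cB.
      by move=> /eqP BE; rewrite BE aA in aB.
    by exists b => //; rewrite orbT.
  exists k => //; split; last by rewrite k2.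
  rewrite EA negb_or; apply/andP; split; first by apply: contraNneq aB => <-.
  by apply: contraTneq k2 => ->; rewrite -leqNgt.
- apply/set0Pn; exists [set i : 'I_n | (i < 2)%N]%SET.
  by rewrite !inE eqxx.
- exact: finset.subsetT.
Qed.

End RankTwo.

(* Main.v *)
Require Import Defs.
From mathcomp Require Import all_boot all_order all_algebra all_fingroup.
From mathcomp Require Import boolp classical_sets cardinality reals.
From mathcomp Require Import zify ring lra.

(* A rank two matroid is given by its m non-loops and their partition into
   parallel classes of sizes a_1, ..., a_k. The lattice points of tP are the
   nonnegative vectors supported on the non-loops with sum 2t and all class sums
   at most t, because a base meeting the two heaviest classes can be subtracted.
   At most one class sum can exceed t, and with N = m - 1 a class of size a does
   so for exactly sum_(i < a) d_i(t) vectors of sum 2t, where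
     d_i(t) = C(t+i, i) C(t+N-i-1, N-i) = (t+1)_i (t)_(N-i) / (i! (N-i)!),
   and (x)_i is the rising factorial. Hence ehr(t) = phi(m) - sum_j phi(a_j) with
   phi(a) = sum_(i < a) d_i. Coefficientwise d_i <= d_i' whenever i < i' and
   i + i' <= N, strictly in degrees 1, ..., N if i + i' < N; pairing i with
   a + c - 1 - i gives phi(a) + phi(c) <= phi(e) + phi(a+c-e) for e <= a, c and
   a + c <= m. So sum_j phi(a_j) is smallest when all a_j = 1 and, for k >= 3,
   largest for the sizes 1, 1, m-2. *)

Set Implicit Arguments.
Unset Strict Implicit.
Unset Printing Implicit Defensive.

Import Order.TTheory GRing.Theory Num.Theory.
Local Open Scope ring_scope.

(** * Coefficients of the polynomials d_i *)

Section PositiveCoefficients.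
Variable R : realFieldType.
Implicit Types (p q : {poly R}) (c d k : nat).

Definition coefs_ge0 p := forall j, 0 <= p`_j.
Definition coefs_gt0 d p := forall j, (j <= d)%N -> 0 < p`_j.

Lemma coefs_ge0M p q : coefs_ge0 p -> coefs_ge0 q -> coefs_ge0 (p * q).
Proof. by move=> hp hq j; rewrite coefM sumr_ge0 // => i _; rewrite mulr_ge0. Qed.

Lemma coefs_gt0M d e p q : coefs_ge0 p -> coefs_ge0 q ->
  coefs_gt0 d p -> coefs_gt0 e q -> coefs_gt0 (d + e) (p * q).
Proof.
move=> hp hq gp gq j hj; rewrite coefM.
have hi : (minn j d < j.+1)%N by rewrite ltnS geq_minl.
rewrite (bigD1 (Ordinal hi)) //= ltr_wpDr ?sumr_ge0 //.
  by move=> i _; rewrite mulr_ge0.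
by rewrite mulr_gt0 ?gp ?gq //; lia.
Qed.

Lemma coef_linear x y j :
  (x *: 'X + y%:P : {poly R})`_j = if j is k.+1 then (if k is 0%N then x else 0) else y.
Proof.
by rewrite coefD coefZ coefX coefC; case: j => [|[|j]] /=;
   rewrite ?mulr0 ?mulr1 ?addr0 ?add0r.
Qed.

Definition rising c k : {poly R} := \prod_(j < k) ('X + (c + j)%:R%:P).

Lemma risingSr c k : rising c k.+1 = rising c k * ('X + (c + k)%:R%:P).
Proof. by rewrite /rising big_ord_recr. Qed.

Lemma risingS c k : rising c k.+1 = ('X + c%:R%:P) * rising c.+1 k.
Proof.
rewrite /rising big_ord_recl /= addn0; congr (_ * _); apply: eq_bigr => i _.
by rewrite /bump /= addnCA addnA addnC addnA.
Qed.

Lemma rising0S k : rising 0 k.+1 = 'X * rising 1 k.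
Proof. by rewrite risingS addr0. Qed.

Lemma risingD c k l : rising c (k + l) = rising c k * rising (c + k) l.
Proof.
rewrite /rising big_split_ord /=; congr (_ * _); apply: eq_bigr => i _.
by rewrite addnA.
Qed.

(** Both products contain [rising c.+1 k], and the two leftover linear factors differ by k+1. *)
Lemma rising_shift c k :
  rising c.+1 k.+1 - rising c k.+1 = k.+1%:R *: rising c.+1 k.
Proof.
rewrite risingSr risingS [('X + _) * _]mulrC -mulrBr mulrC -mul_polyC.
congr (_ * _).
rewrite opprD addrACA subrr add0r -polyCB -natrB; last by lia.
by congr (_%:R%:P); lia.
Qed.

Lemma rising_ge0 c k : coefs_ge0 (rising c k).
Proof.
elim: k => [|k IH].
  by move=> j; rewrite /rising big_ord0 coef1 ler0n.
rewrite risingSr; apply: coefs_ge0M => // j.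
by rewrite -['X]scale1r coef_linear; case: j => [|[|j]].
Qed.

Lemma rising_gt0 c k : coefs_gt0 k (rising c.+1 k).
Proof.
elim: k => [|k IH].
  by move=> j; rewrite leqn0 => /eqP ->; rewrite /rising big_ord0 coef1.
rewrite risingSr -addn1; apply: coefs_gt0M => //.
- exact: rising_ge0.
- by move=> j; rewrite -['X]scale1r coef_linear; case: j => [|[|j]].
- by move=> j; rewrite -['X]scale1r coef_linear; case: j => [|[|j]] //; lra.
Qed.

(* The polynomial d_i of the header. *)
Definition layer (N i : nat) : {poly R} :=
  ((i`! * (N - i)`!)%:R)^-1 *: (rising 1 i * rising 0 (N - i)).

(** The two layers share [rising 1 a * rising 0 b]; over the denominator (a+1)! (b+1)! what is left
    is (b+1)(X+a+1) - (a+1)(X+b), whose coefficients are nonnegative once a <= b. *)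
Lemma layer_step a b :
  layer (a.+1 + b) a.+1 - layer (a.+1 + b) a =
  ((a.+1`! * b.+1`!)%:R)^-1 *:
    (rising 1 a * rising 0 b * ((b.+1%:R - a.+1%:R) *: 'X + a.+1%:R%:P)).
Proof.
rewrite /layer addKn (_ : a.+1 + b - a = b.+1)%N; last by lia.
have f0 k : (k`!)%:R != 0 :> R by rewrite pnatr_eq0 -lt0n fact_gt0.
have s0 k : k.+1%:R != 0 :> R by rewrite pnatr_eq0.
rewrite !risingSr add0n add1n !factS !natrM.
set p := rising 1 a; set q := rising 0 b.
have -> : (a.+1%:R * (a`!)%:R * (b`!)%:R : R)^-1 =
  (a.+1%:R * (a`!)%:R * (b.+1%:R * (b`!)%:R))^-1 * b.+1%:R.
  by field; rewrite !nat1r !f0 !s0.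
have -> : ((a`!)%:R * (b.+1%:R * (b`!)%:R) : R)^-1 =
  (a.+1%:R * (a`!)%:R * (b.+1%:R * (b`!)%:R))^-1 * a.+1%:R.
  by field; rewrite !nat1r !f0 !s0.
rewrite -!scalerA -scalerBr; congr (_ *: _).
rewrite -!mul_polyC -!natr1 !polyCB !polyCD !polyC1; ring.
Qed.

(** Mirror indices i and N-i have equal denominators; once the common factors are taken out, the
    difference is an instance of [rising_shift]. *)
Lemma layer_reflect i k :
  layer (i + i + k.+1) (i + k.+1) - layer (i + i + k.+1) i =
  ((i`! * (i + k.+1)`!)%:R)^-1 * k.+1%:R *:
    (rising 1 i * rising 0 i * rising i.+1 k).
Proof.
rewrite /layer (_ : i + i + k.+1 - (i + k.+1) = i)%N; last by lia.
rewrite (_ : i + i + k.+1 - i = i + k.+1)%N; last by lia.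
rewrite [((i + _)`! * _)%N]mulnC -scalerBr -scalerA; congr (_ *: _).
rewrite !risingD add0n add1n scalerAr -rising_shift; ring.
Qed.

End PositiveCoefficients.

Section LayerCoefficients.
Variables (R : realFieldType) (N : nat).
Local Notation layer := (@layer R).

Let inv_gt0 k l : 0 < ((k`! * l`!)%:R)^-1 :> R.
Proof. by rewrite invr_gt0 ltr0n muln_gt0 !fact_gt0. Qed.

(** In [layer_step] the factor [rising 0] contains X exactly once, which kills degree 0; the
    cofactor has degree N-1 and only positive coefficients, whence strictness in degrees 1 to N. *)
Lemma layer_incr i j : (i.+1.*2 <= N)%N ->
  (layer N i)`_j <= (layer N i.+1)`_j /\
  ((1 <= j <= N)%N -> (layer N i)`_j < (layer N i.+1)`_j).
Proof.
move=> hi; have [b EN bi] : exists2 b, N = (i.+1 + b.+1)%N & (i <= b)%N.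
  by exists (N - i - 2)%N; lia.
rewrite -subr_ge0 -subr_gt0 EN -coefB layer_step coefZ.
rewrite rising0S mulrCA -!mulrA coefXM.
have lin0 : coefs_ge0 ((b.+2%:R - i.+1%:R) *: 'X + i.+1%:R%:P : {poly R}).
  move=> k; rewrite coef_linear -natrB; last by lia.
  by case: k => [|[|k]].
have lin1 : coefs_gt0 1 ((b.+2%:R - i.+1%:R) *: 'X + i.+1%:R%:P : {poly R}).
  move=> k; rewrite coef_linear -natrB; last by lia.
  by case: k => [|[|k]] // _; rewrite ltr0n; lia.
split.
  apply: mulr_ge0; [exact: ltW|case: j => [|j] //=].
  exact: (coefs_ge0M (@rising_ge0 _ _ _) (coefs_ge0M (@rising_ge0 _ _ _) lin0)).
case: j => [|j] //= hj; rewrite mulr_gt0 //.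
have g : coefs_gt0 (i + (b + 1)) (rising R 1 i * (rising R 1 b *
    ((b.+2%:R - i.+1%:R) *: 'X + i.+1%:R%:P))).
  apply: coefs_gt0M; rewrite ?rising_gt0 //; first exact: rising_ge0.
  - by apply: coefs_ge0M => //; exact: rising_ge0.
  - exact: rising_gt0.
  apply: coefs_gt0M; rewrite ?rising_gt0 //; first exact: rising_ge0.
  exact: rising_gt0.
by apply: g; lia.
Qed.

Lemma layer_le_reflect i i' j : (i < i')%N -> (i + i' = N)%N ->
  (layer N i)`_j <= (layer N i')`_j.
Proof.
move=> ii' EN; have [k Ek] : exists k, (i' = i + k.+1)%N by exists (i' - i.+1)%N; lia.
rewrite -subr_ge0 -EN Ek addnA -coefB layer_reflect coefZ.
apply: mulr_ge0; last first.
  exact: (coefs_ge0M (coefs_ge0M (@rising_ge0 _ _ _) (@rising_ge0 _ _ _)) (@rising_ge0 _ _ _)).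
by apply: mulr_ge0 => //; exact: ltW.
Qed.

Lemma layer_chain i i' j : (i < i')%N -> (i'.*2 <= N)%N ->
  (layer N i)`_j <= (layer N i')`_j /\
  ((1 <= j <= N)%N -> (layer N i)`_j < (layer N i')`_j).
Proof.
elim: i' => // i' IH; rewrite ltnS leq_eqVlt => /orP[/eqP <-|lt] h2.
  by apply: layer_incr; lia.
have [||le1 lt1] := IH; [done|by lia|].
have [|le2 lt2] := @layer_incr i' j; first by lia.
split; first exact: le_trans le2.
by move=> hj; apply: lt_trans (lt1 hj) (lt2 hj).
Qed.

(** Up to N/2 the layers increase. An i' beyond N/2 is first replaced by its mirror N-i', which has
    the smaller coefficient and is still at least i. *)
Lemma layer_le i i' j : (i < i')%N -> (i + i' <= N)%N ->
  (layer N i)`_j <= (layer N i')`_j.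
Proof.
move=> ii' sN; have [h|h] := leqP i'.*2 N; first by have [] := layer_chain j ii' h.
have r : (layer N (N - i'))`_j <= (layer N i')`_j by apply: layer_le_reflect; lia.
have [E|ne] := eqVneq i (N - i')%N; first by rewrite E.
by apply: le_trans r; have [||] := @layer_chain i (N - i') j; lia.
Qed.

(** Now the mirror N-i' lies strictly above i, so the increasing half already gives a strict
    step. *)
Lemma layer_lt i i' j : (i < i')%N -> (i + i' < N)%N -> (1 <= j <= N)%N ->
  (layer N i)`_j < (layer N i')`_j.
Proof.
move=> ii' sN hj; have [h|h] := leqP i'.*2 N; first by have [_] := layer_chain j ii' h; apply.
have r : (layer N (N - i'))`_j <= (layer N i')`_j by apply: layer_le_reflect; lia.
by apply: lt_le_trans r; have [|| _] := @layer_chain i (N - i') j; [lia|lia|apply].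
Qed.

(** The mirror pair 0, N is outside the range of [layer_lt]. Its difference is a positive multiple
    of [rising 1 N.-1], hence positive in every degree below N, degree 0 included. *)
Lemma layer0_lt_layerN j : (j < N)%N -> (layer N 0)`_j < (layer N N)`_j.
Proof.
case EN : N => [|k] // hj; have := @layer_reflect R 0 k.
rewrite !add0n => /(congr1 (fun p : {poly R} => p`_j)); rewrite coefB.
rewrite /rising !big_ord0 !mul1r -/(rising R 1 k) => E.
rewrite -subr_gt0 E coefZ; apply: mulr_gt0; last exact: rising_gt0.
exact: mulr_gt0.
Qed.

End LayerCoefficients.

(** * Inequalities between partial sums *)

Definition psum (V : nmodType) (f : nat -> V) a := \sum_(i < a) f i.

Section PartialSums.
Variables (R : realFieldType) (N : nat) (d : nat -> R).
Hypothesis d_le : forall i i', (i < i')%N -> (i + i' <= N)%N -> d i <= d i'.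

Local Notation phi := (psum d).

(** A premise of the strict lemmas only: for the layer coefficients of degree j it is available when
    1 <= j <= N, whereas [d_le] holds in every degree. *)
Let d_lt := forall i i', (i < i')%N -> (i + i' < N)%N -> d i < d i'.

(** The exchange adds the terms with index in [c, a+c-e) and drops those in [e, a); reversing the
    first range pairs a+c-1-i with i. *)
Lemma psum_exchange e a c : (e <= a)%N -> (a <= c)%N ->
  phi e + phi (a + c - e)%N - (phi a + phi c) =
  \sum_(e <= i < a) (d (a + c - i.+1)%N - d i).
Proof.
move=> ea ac; have E k : phi k = \sum_(0 <= i < k) d i by rewrite big_mkord.
rewrite !E sumrB (big_cat_nat (n := e) (p := a)) //=.
rewrite (big_cat_nat (n := c) (p := (a + c - e)%N)) //=; last by lia.
have -> : \sum_(c <= i < a + c - e) d i = \sum_(e <= i < a) d (a + c - i.+1)%N.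
  rewrite big_nat_rev /= -[in LHS](add0n c) big_addn -[in RHS](add0n e) big_addn.
  rewrite add0n (_ : a + c - e - c = a - e)%N; last by lia.
  by rewrite !big_mkord; apply: eq_bigr => i _; congr d; have := ltn_ord i; lia.
ring.
Qed.

Lemma psum_exchange_le e a c : (e <= a)%N -> (e <= c)%N -> (a + c <= N.+1)%N ->
  phi a + phi c <= phi e + phi (a + c - e)%N.
Proof.
wlog ac : a c / (a <= c)%N.
  move=> H ea ec h; have [ac|/ltnW ca] := leqP a c; first exact: H.
  by rewrite addrC addnC; apply: H => //; rewrite addnC.
move=> ea _ h; rewrite -subr_ge0 psum_exchange // big_nat_cond sumr_ge0 // => i.
by rewrite andbT => /andP[ei ia]; rewrite subr_ge0 d_le //; lia.
Qed.

(** Paired indices add up to a+c-1, so strict comparison needs a+c <= N, one less than the weak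
    form. The pair of i = e alone provides strictness. *)
Lemma psum_exchange_lt e a c : d_lt -> (e < a)%N -> (e < c)%N -> (a + c <= N)%N ->
  phi a + phi c < phi e + phi (a + c - e)%N.
Proof.
move=> dlt; wlog ac : a c / (a <= c)%N.
  move=> H ea ec h; have [ac|/ltnW ca] := leqP a c; first exact: H.
  by rewrite addrC addnC; apply: H => //; rewrite addnC.
move=> ea _ h; rewrite -subr_gt0 psum_exchange // ?(ltnW ea) // big_ltn //.
apply: ltr_wpDr; last by rewrite subr_gt0 dlt //; lia.
rewrite big_nat_cond sumr_ge0 // => i /andP[/andP[ei ia] _].
by rewrite subr_ge0 d_le //; lia.
Qed.

Lemma psum0 : phi 0 = 0.
Proof. by rewrite /psum big_ord0. Qed.

Lemma psumD_le a c : (a + c <= N.+1)%N -> phi a + phi c <= phi (a + c)%N.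
Proof.
by move=> h; have := @psum_exchange_le 0 a c; rewrite psum0 add0r subn0; apply.
Qed.

Lemma psumD_lt a c : d_lt -> (0 < a)%N -> (0 < c)%N -> (a + c <= N)%N ->
  phi a + phi c < phi (a + c)%N.
Proof.
move=> dlt ha hc h; have := @psum_exchange_lt 0 a c dlt.
by rewrite psum0 add0r subn0; apply.
Qed.

(** Here paired indices add up to exactly N, beyond the reach of [d_lt]; the pair 0, N is strict by
    assumption. *)
Lemma psumD_lt_total a c : d 0 < d N -> (0 < a)%N -> (0 < c)%N ->
  (a + c = N.+1)%N -> phi a + phi c < phi N.+1.
Proof.
move=> d0N; wlog ac : a c / (a <= c)%N.
  move=> H ha hc h; have [ac|/ltnW ca] := leqP a c; first exact: H.
  by rewrite addrC; apply: H => //; rewrite addnC.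
move=> ha hc h; have := @psum_exchange 0 a c isT ac.
rewrite psum0 add0r subn0 -subr_gt0 h => ->; rewrite big_ltn //.
apply: ltr_wpDr; last by rewrite subr_gt0 subn1.
rewrite big_nat_cond sumr_ge0 // => i /andP[/andP[ei ia] _].
by rewrite subr_ge0 d_le //; lia.
Qed.

Lemma psum_sum_le (I : Type) (r : seq I) (P : pred I) (a : I -> nat) :
  (\sum_(i <- r | P i) a i <= N.+1)%N ->
  \sum_(i <- r | P i) phi (a i) <= phi (\sum_(i <- r | P i) a i)%N.
Proof.
elim/big_rec2: _ => [|i f s _ IH]; first by rewrite psum0.
move=> h; apply: le_trans (psumD_le h); rewrite lerD2l IH //.
by apply: leq_trans h; exact: leq_addl.
Qed.

Lemma psum_ge a : (a <= N.+1)%N -> phi 1 *+ a <= phi a.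
Proof.
move=> h; rewrite /psum big_ord1 -{1}(card_ord a) -sumr_const ler_sum // => -[[|i] hi] _ //=.
by apply: d_le; lia.
Qed.

Lemma psum_gt a : d_lt -> (1 < a)%N -> (a <= N)%N -> phi 1 *+ a < phi a.
Proof.
case: a => // a dlt ha h; rewrite /psum big_ord1 big_ord_recr /= mulrS addrC.
apply: ler_ltD; last by apply: dlt => //; lia.
by have := @psum_ge a; rewrite /psum big_ord1; apply; lia.
Qed.

(** Two exchanges: (a, b) becomes (1, a+b-1), then (a+b-1, c) becomes (1, N-1). *)
Lemma psum3_le a b c : (0 < a)%N -> (0 < b)%N -> (0 < c)%N ->
  (a + b + c = N.+1)%N -> phi a + phi b + phi c <= phi 1 + phi 1 + phi N.-1.
Proof.
move=> ha hb hc h.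
have h1 : phi a + phi b <= phi 1 + phi (a + b - 1)%N by apply: psum_exchange_le; lia.
have h2 : phi (a + b - 1)%N + phi c <= phi 1 + phi N.-1.
  have -> : N.-1 = (a + b - 1 + c - 1)%N by lia.
  by apply: psum_exchange_le; lia.
lra.
Qed.

(** The first exchange is strict if a, b > 1. Otherwise one of them is 1, so the excluded cases
    leave c > 1 and a+b-1 > 1, and the second exchange is strict. *)
Lemma psum3_lt a b c : d_lt -> (0 < a)%N -> (0 < b)%N -> (0 < c)%N ->
  (a + b + c = N.+1)%N ->
  ~ [\/ a = 1%N /\ b = 1%N, a = 1%N /\ c = 1%N | b = 1%N /\ c = 1%N] ->
  phi a + phi b + phi c < phi 1 + phi 1 + phi N.-1.
Proof.
move=> dlt ha hb hc h no.
have e2 : N.-1 = (a + b - 1 + c - 1)%N by lia.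
have h1 : phi a + phi b <= phi 1 + phi (a + b - 1)%N by apply: psum_exchange_le; lia.
have h2 : phi (a + b - 1)%N + phi c <= phi 1 + phi N.-1.
  by rewrite e2; apply: psum_exchange_le; lia.
have [/andP[a1 b1]|n1] := boolP ((1 < a) && (1 < b))%N.
  have h1' : phi a + phi b < phi 1 + phi (a + b - 1)%N by apply: psum_exchange_lt => //; lia.
  lra.
have c1 : (1 < c)%N.
  rewrite ltnNge; apply/negP => c1; apply: no; move: n1; rewrite negb_and -!leqNgt.
  by case/orP => ?; [apply: Or32|apply: Or33]; lia.
have ab1 : (1 < a + b - 1)%N.
  by rewrite ltnNge; apply/negP => ab; apply: no; apply: Or31; lia.
have h2' : phi (a + b - 1)%N + phi c < phi 1 + phi N.-1.
  by rewrite e2; apply: psum_exchange_lt => //; lia.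
lra.
Qed.

Section Families.
Variables (I : finType) (a : I -> nat).
Hypothesis sum_a : (\sum_l a l = N.+1)%N.

Let split3 l1 l2 : l1 != l2 ->
  (a l1 + a l2 + \sum_(l | (l != l1) && (l != l2)) a l = N.+1)%N.
Proof.
by move=> ne; rewrite -sum_a [RHS](bigD1 l1) //= [in RHS](bigD1 l2) /= ?addnA // eq_sym.
Qed.

Let rest l1 l2 := (\sum_(l | (l != l1) && (l != l2)) a l)%N.

Lemma psum_family_le3 l1 l2 : l1 != l2 ->
  \sum_l phi (a l) <= phi (a l1) + phi (a l2) + phi (rest l1 l2).
Proof.
move=> ne; rewrite (bigD1 l1) //= (bigD1 l2) /=; last by rewrite eq_sym.
by rewrite addrA lerD2l psum_sum_le //; have := split3 ne; lia.
Qed.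

(** All classes but l1 and l2 are merged; merging l3 with l4 is strict because l1 and l2 keep their
    joint size at most N. *)
Lemma psum_family_lt3 l1 l2 l3 l4 : d_lt -> uniq [:: l1; l2; l3; l4] ->
  all (fun l => 0 < a l)%N [:: l1; l2; l3; l4] ->
  \sum_l phi (a l) < phi (a l1) + phi (a l2) + phi (rest l1 l2).
Proof.
move=> dlt; rewrite /= !inE !negb_or => /and4P[/and3P[n12 n13 n14] /andP[n23 n24] n34 _].
move=> /and5P[h1 h2 h3 h4 _].
rewrite [ltLHS](bigD1 l1) //= [in ltLHS](bigD1 l2) /=; last by rewrite eq_sym.
rewrite addrA ltrD2l; have := split3 n12; rewrite /rest.
have p3 : (l3 != l1) && (l3 != l2) by rewrite eq_sym n13 eq_sym.
have p4 : (l4 != l1) && (l4 != l2) && (l4 != l3).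
  by rewrite eq_sym n14 eq_sym n24 eq_sym.
rewrite (bigD1 l3) //= (bigD1 (P := fun l => _ && _ && _) l4) //=.
rewrite [X in _ -> X < _](bigD1 l3) //= [X in _ -> _ + X < _](bigD1 l4) //=.
pose P l := (l != l1) && (l != l2) && (l != l3) && (l != l4).
pose s := (\sum_(l | P l) a l)%N; rewrite -/s => h.
have r : \sum_(l | P l) phi (a l) <= phi s by apply: psum_sum_le; rewrite -/s; lia.
have g : phi (a l3) + phi (a l4) < phi (a l3 + a l4)%N by apply: psumD_lt => //; lia.
have g' : phi (a l3 + a l4)%N + phi s <= phi (a l3 + (a l4 + s))%N.
  by rewrite addnA; apply: psumD_le; lia.
lra.
Qed.

Lemma psum_family_le l1 l2 l3 : uniq [:: l1; l2; l3] ->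
  all (fun l => 0 < a l)%N [:: l1; l2; l3] ->
  \sum_l phi (a l) <= phi 1 + phi 1 + phi N.-1.
Proof.
rewrite /= !inE negb_or => /and3P[/andP[n12 n13] n23 _] /and4P[h1 h2 h3 _].
apply: le_trans (psum_family_le3 n12) _; apply: psum3_le => //; last exact: split3.
by rewrite /rest (bigD1 l3) /= ?addn_gt0 ?h3 // eq_sym n13 eq_sym.
Qed.

(** The last premise rules out the sizes 1, 1, N-1 of the minimal matroid. Strictness comes from
    merging if a fourth class is nonempty, and from [psum3_lt] if there are only three. *)
Lemma psum_family_lt l1 l2 l3 : d_lt -> uniq [:: l1; l2; l3] ->
  all (fun l => 0 < a l)%N [:: l1; l2; l3] ->
  (forall l l', a l = 1%N -> a l' = 1%N -> l != l' ->
    exists k k', [/\ uniq [:: l; l'; k; k'], (0 < a k)%N & (0 < a k')%N]) ->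
  \sum_l phi (a l) < phi 1 + phi 1 + phi N.-1.
Proof.
move=> dlt; rewrite /= !inE negb_or => /and3P[/andP[n12 n13] n23 _].
move=> /and4P[h1 h2 h3 _] no.
have pr l l' k : l != l' -> k != l -> k != l' -> (0 < a k)%N -> (0 < rest l l')%N.
  by move=> ll' kl kl' hk; rewrite /rest (bigD1 k) /= ?addn_gt0 ?hk // kl.
(* Two classes of size 1 come with two further nonempty ones, and merging these is strict. *)
have H l l' k : l != l' -> k != l -> k != l' -> (0 < a k)%N ->
    a l = 1%N -> a l' = 1%N -> \sum_l phi (a l) < phi 1 + phi 1 + phi N.-1.
  move=> ll' kl kl' hk al al'; have [j [j' [u hj hj']]] := no _ _ al al' ll'.
  apply: lt_le_trans (psum_family_lt3 dlt u _) _.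
    by rewrite /= al al' hj hj'.
  by apply: psum3_le; rewrite ?al ?al' //; [exact: pr hk|rewrite -(split3 ll') al al'].
have [[u1 u2]|n1] := pselect (a l1 = 1%N /\ a l2 = 1%N).
  by apply: (H l1 l2 l3); rewrite // eq_sym.
have [[u1 u2]|n2] := pselect (a l1 = 1%N /\ a l3 = 1%N).
  by apply: (H l1 l3 l2); rewrite // eq_sym.
have [[u1 u2]|n3] := pselect (a l2 = 1%N /\ a l3 = 1%N).
  by apply: (H l2 l3 l1).
have [[l4 /andP[/and3P[m1 m2 m3] h4]]|n4] :=
  pselect (exists l4, [&& l4 != l1, l4 != l2 & l4 != l3] && (0 < a l4)%N).
  apply: lt_le_trans (@psum_family_lt3 l1 l2 l3 l4 dlt _ _) _.
  - rewrite /= !inE !negb_or n12 n13 n23 [l1 == l4]eq_sym m1.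
    by rewrite [l2 == l4]eq_sym m2 [l3 == l4]eq_sym m3.
  - by rewrite /= h1 h2 h3 h4.
  by apply: psum3_le => //; [apply: (pr _ _ l3); rewrite // eq_sym|exact: split3].
(* Exactly three nonempty classes remain, no two of them of size 1. *)
apply: le_lt_trans (psum_family_le3 n12) _.
have -> : rest l1 l2 = a l3.
  rewrite /rest (bigD1 l3) /=; last by rewrite eq_sym n13 eq_sym.
  rewrite big1 ?addn0 // => l /andP[/andP[m1 m2] m3].
  apply/eqP; rewrite -leqn0 leqNgt; apply/negP => h4; apply: n4.
  by exists l; rewrite m1 m2 m3.
apply: psum3_lt => //; last by case.
rewrite -(split3 n12) (bigD1 l3) /=; last by rewrite eq_sym n13 eq_sym.
rewrite big1 ?addn0 // => l /andP[/andP[m1 m2] m3].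
apply/eqP; rewrite -leqn0 leqNgt; apply/negP => h4; apply: n4.
by exists l; rewrite m1 m2 m3.
Qed.

Lemma psum_family_ge : phi 1 *+ N.+1 <= \sum_l phi (a l).
Proof.
rewrite -sum_a -sumrMnr ler_sum // => l _; apply: psum_ge.
by rewrite -sum_a (bigD1 l) //= leq_addr.
Qed.

Lemma psum_family_gt l1 l2 : d_lt -> l1 != l2 -> (1 < a l1)%N -> (0 < a l2)%N ->
  phi 1 *+ N.+1 < \sum_l phi (a l).
Proof.
move=> dlt ne h1 h2; rewrite -sum_a -sumrMnr (bigD1 l1) //= [ltRHS](bigD1 l1) //=.
apply: ltr_leD.
  by apply: psum_gt => //; have := split3 ne; lia.
apply: ler_sum => l _; apply: psum_ge.
by rewrite -sum_a (bigD1 l) //= leq_addr.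
Qed.

(** Merging everything except l1 leaves a pair of total N+1. This covers two classes, in the degrees
    where the mirror pair 0, N is strict. *)
Lemma psum_family_lt_total l1 l2 : d 0 < d N -> l1 != l2 ->
  (0 < a l1)%N -> (0 < a l2)%N -> \sum_l phi (a l) < phi N.+1.
Proof.
move=> d0N ne h1 h2; rewrite (bigD1 l1) //=.
have s : (a l1 + \sum_(l | l != l1) a l = N.+1)%N by rewrite -sum_a [RHS](bigD1 l1).
have p : (0 < \sum_(l | l != l1) a l)%N.
  by rewrite (bigD1 l2) /= ?addn_gt0 ?h2 // eq_sym.
apply: le_lt_trans (psumD_lt_total d0N h1 p s).
by rewrite lerD2l; apply: psum_sum_le; rewrite -s leq_addl.
Qed.

Lemma psum_family_lt_total3 l1 l2 l3 : d_lt -> uniq [:: l1; l2; l3] ->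
  all (fun l => 0 < a l)%N [:: l1; l2; l3] -> \sum_l phi (a l) < phi N.+1.
Proof.
rewrite /= !inE negb_or => dlt /and3P[/andP[n12 n13] n23 _] /and4P[h1 h2 h3 _].
apply: le_lt_trans (psum_family_le3 n12) _; have s := split3 n12.
have p : (0 < rest l1 l2)%N.
  by rewrite /rest (bigD1 l3) /= ?addn_gt0 ?h3 // eq_sym n13 eq_sym.
have g : phi (a l1) + phi (a l2) < phi (a l1 + a l2)%N.
  by apply: psumD_lt => //; rewrite -ltnS -s -/(rest _ _); lia.
have g' : phi (a l1 + a l2)%N + phi (rest l1 l2) <= phi N.+1.
  by rewrite -s; apply: psumD_le; rewrite s.
lra.
Qed.

End Families.

End PartialSums.

(** * Counting *)

Section Compositions.
Local Open Scope nat_scope.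

(* The number of weak compositions of w into k parts; the predecessor makes
   this 0 for k = 0 < w. *)
Definition wcomp k w := 'C((w + k).-1, w).

Lemma wcomp0 w : wcomp 0 w = (w == 0).
Proof. by case: w => [|w]; rewrite /wcomp addn0 /= ?bin0 // bin_small. Qed.

Lemma wcompk0 k : wcomp k 0 = 1.
Proof. by rewrite /wcomp bin0. Qed.

Lemma wcompS k w : wcomp k.+1 w.+1 = wcomp k.+1 w + wcomp k w.+1.
Proof. by rewrite /wcomp !addnS !addSn /= binS addnC. Qed.

Lemma wcomp_sum k w : \sum_(i < w.+1) wcomp k i = wcomp k.+1 w.
Proof.
elim: w => [|w IH]; first by rewrite big_ord_recl big_ord0 !wcompk0.
by rewrite big_ord_recr IH wcompS.
Qed.

(** Cutting the geometric series at degree W keeps it a polynomial and does not change coefficients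
    up to W. *)
Lemma coef_geometric W k w : w <= W ->
  (((\sum_(j < W.+1) 'X^j : {poly nat}) ^+ k)`_w)%R = wcomp k w.
Proof.
elim: k w => [|k IH] w hw; first by rewrite expr0 coef1 wcomp0; case: (w == 0).
rewrite exprSr coefM -wcomp_sum; apply: eq_bigr => i _.
have hi := ltn_ord i; rewrite IH; last by lia.
suff -> : ((\sum_(j < W.+1) 'X^j : {poly nat})`_(w - i))%R = 1 by rewrite mulr1.
have hwi : w - i < W.+1 by lia.
rewrite coef_sum (bigD1 (Ordinal hwi)) //= coefXn eqxx big1 // => j ne.
by rewrite coefXn; case: eqP => // E; case/eqP: ne; apply: val_inj.
Qed.

Lemma wcompD p q w : \sum_(i < w.+1) wcomp p i * wcomp q (w - i) = wcomp (p + q) w.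
Proof.
rewrite -(@coef_geometric w) // exprD coefM; apply: eq_bigr => i _.
by have hi := ltn_ord i; rewrite !(@coef_geometric w) //; lia.
Qed.

(* Both sides differ by a telescoping sum. *)
Lemma wcomp_conv_step a b u k :
  \sum_(r < k) wcomp a.+1 (u + r.+1) * wcomp b (k - r.+1) =
  \sum_(r < k) wcomp a (u + r.+1) * wcomp b.+1 (k - r.+1) +
  wcomp a.+1 u * (if k is k'.+1 then wcomp b.+1 k' else 0).
Proof.
(* The cut-off makes G k vanish, so shifting the index costs only G 0. *)
pose G r := wcomp a.+1 (u + r) * (if r < k then wcomp b.+1 (k - r.+1) else 0).
have T : \sum_(r < k) G r.+1 + G 0 = \sum_(r < k) G r.
  have: \sum_(r < k.+1) G r = G 0 + \sum_(r < k) G r.+1 by rewrite big_ord_recl.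
  by rewrite big_ord_recr /= [G k]/G ltnn muln0 addn0 addnC => <-.
have -> : wcomp a.+1 u * (if k is k'.+1 then wcomp b.+1 k' else 0) = G 0.
  by rewrite /G addn0; case: k {T G} => [|k] //=; rewrite subn1.
apply/eqP; rewrite -(eqn_add2l (\sum_(r < k) G r.+1)) addnCA T -!big_split /=.
apply/eqP; apply: eq_bigr => r _; rewrite /G ltn_ord addnS wcompS.
have [h|h] := ltnP r.+1 k.
  have -> : k - r.+1 = (k - r.+2).+1 by lia.
  by rewrite [in RHS]wcompS; ring.
have -> : k - r.+1 = 0 by lia.
by rewrite !wcompk0; ring.
Qed.

End Compositions.

(** * Values of the layers at natural numbers *)

Section LayerValues.
Variable R : realFieldType.

Lemma rising_nat c k t : (rising R c k).[t%:R] = ((t + c + k).-1 ^_ k)%:R.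
Proof.
elim: k c => [|k IH] c; first by rewrite /rising big_ord0 hornerE ffactn0.
rewrite risingS hornerM IH !hornerE -natrD -natrM; congr _%:R.
by rewrite !addnS addSn /= ffactnSr mulnC addnK.
Qed.

Lemma layer_nat N i t : (i <= N)%N ->
  (layer R N i).[t%:R] = (wcomp t.+1 i * wcomp t (N - i))%:R.
Proof.
move=> hi; rewrite /layer hornerZ hornerM !rising_nat -natrM.
apply: (canLR (mulKf _)); first by rewrite pnatr_eq0 -lt0n muln_gt0 !fact_gt0.
rewrite -natrM; congr _%:R; rewrite /wcomp addnAC addn1 addn0 !addnS /=.
by rewrite mulnACA ![(_`! * _)%N]mulnC !bin_ffact [(i + t)%N]addnC [(N - i + t)%N]addnC.
Qed.

(** The convolution counts compositions of N into 2t+1 parts; binomial symmetry turns them into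
    compositions of 2t into N+1 parts. *)
Lemma sum_layer_nat N t :
  \sum_(i < N.+1) (layer R N i).[t%:R] = (wcomp N.+1 t.*2)%:R.
Proof.
rewrite (eq_bigr (fun i : 'I_N.+1 => (wcomp t.+1 i * wcomp t (N - i))%:R)); last first.
  by move=> i _; rewrite layer_nat // -ltnS.
rewrite -natr_sum wcompD /wcomp; congr _%:R.
have -> : ((N + (t.+1 + t)).-1 = N + t.*2)%N by lia.
have -> : ((t.*2 + N.+1).-1 = N + t.*2)%N by lia.
by rewrite -[in RHS]bin_sub ?leq_addl // addnK.
Qed.

(** The right side counts vectors of sum 2t with N+1 entries whose first a entries sum to more than
    t. Raising a by one changes it by the boundary term of [wcomp_conv_step], which is d_a(t) by
    binomial symmetry. *)
Lemma psum_layer_nat N a t : (a <= N)%N ->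
  \sum_(i < a) (layer R N i).[t%:R] =
  (\sum_(r < t) wcomp a (t + r.+1) * wcomp (N.+1 - a) (t - r.+1))%:R.
Proof.
elim: a => [|a IH] ha.
  rewrite big_ord0 big1 // => r _.
  by rewrite wcomp0 addnS mul0n.
rewrite big_ord_recr /= IH ?(ltnW ha) // layer_nat ?(ltnW ha) // -natrD; congr _%:R.
rewrite subSS (_ : N.+1 - a = (N - a).+1)%N; last by lia.
rewrite wcomp_conv_step; congr (_ + _)%N.
have -> : wcomp t.+1 a = wcomp a.+1 t.
  by rewrite /wcomp !addnS /= [in RHS]addnC -[in RHS]bin_sub ?leq_addl // addnK.
(* Positivity of N-a makes both sides 0 at t = 0. *)
congr (_ * _)%N; have [b Eb] : exists b, (N - a = b.+1)%N by exists (N - a).-1; lia.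
rewrite Eb; case: t {IH} => [|t]; first by rewrite /wcomp addn0 bin_small.
rewrite /wcomp !addnS !addSn /= -[in RHS]bin_sub; last by lia.
by congr 'C(_, _); lia.
Qed.

End LayerValues.

(** * Lattice points and integer decomposition *)

Section TransversalPairs.
Variables (n : nat) (E : {set 'I_n}) (lab : 'I_n -> 'I_n).
Implicit Types (i j l : 'I_n) (B : {set 'I_n}).

(* A rank two matroid: E is the set of non-loops, and the parallel classes are
   the fibres of [lab] over E. *)
Definition transversal_pairs : {set {set 'I_n}} :=
  [set B : {set 'I_n} | [exists i in E, [exists j in E,
     (lab i != lab j) && (B == [set i; j]%SET)]]]%SET.

Definition lab_class l : {set 'I_n} := [set i in E | lab i == l]%SET.

Lemma transversal_pairsP B : reflect
  (exists i j, [/\ i \in E, j \in E, lab i != lab j & B = [set i; j]%SET])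
  (B \in transversal_pairs).
Proof.
rewrite inE; apply: (iffP exists_inP) => [[i iE /exists_inP[j jE /andP[ij /eqP ->]]]|].
  by exists i, j.
move=> [i [j [iE jE ij ->]]]; exists i => //; apply/exists_inP; exists j => //.
by rewrite ij eqxx.
Qed.

Lemma sum_lab_class (V : nmodType) (f : 'I_n -> V) :
  \sum_l \sum_(i in lab_class l) f i = \sum_(i in E) f i.
Proof.
rewrite [RHS](partition_big lab predT) //=; apply: eq_bigr => l _.
by apply: eq_bigl => i; rewrite inE.
Qed.

Lemma sum_pair (V : nmodType) (c : 'I_n -> V) i j : i != j ->
  \sum_(k in [set i; j]%SET) c k = c i + c j.
Proof. by move=> ij; rewrite big_setU1 ?big_set1 // inE. Qed.

Definition admissible (t : nat) (f : 'I_n -> nat) :=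
  [&& [forall (i | i \notin E), f i == 0%N], (\sum_i f i)%N == t.*2 &
      [forall l, (\sum_(i in lab_class l) f i <= t)%N]].

Lemma admissibleP t f : reflect
  [/\ forall i, i \notin E -> f i = 0%N, (\sum_i f i)%N = t.*2 &
      forall l, (\sum_(i in lab_class l) f i <= t)%N]
  (admissible t f).
Proof.
apply: (iffP and3P) => -[h1 h2 h3]; split.
- by move=> i iE; move/forall_inP: h1 => /(_ i iE)/eqP.
- exact/eqP.
- exact/forallP.
- by apply/forall_inP => i iE; rewrite h1.
- exact/eqP.
- exact/forallP.
Qed.

Lemma sum_support (f : 'I_n -> nat) : (forall i, i \notin E -> f i = 0%N) ->
  (\sum_i f i = \sum_(i in E) f i)%N.
Proof.
move=> h; rewrite (bigID (mem E)) /= [X in (_ + X)%N]big1 ?addn0 //.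
Qed.

Lemma sum_nat_mem (T : finType) (A : {set T}) : (\sum_k (k \in A) = #|A|)%N.
Proof. by rewrite -sum1_card [RHS]big_mkcond; apply: eq_bigr => k _; case: (k \in A). Qed.

(* Remove a base meeting the two heaviest classes. *)
Lemma admissible_remove t f : admissible t.+1 f ->
  exists i j (g : 'I_n -> nat), [/\ i \in E, j \in E, lab i != lab j, admissible t g &
    forall k, f k = ((k \in [set i; j]%SET) + g k)%N].
Proof.
move=> /admissibleP[h1 h2 h3].
pose s l := (\sum_(i in lab_class l) f i)%N.
have ss : (\sum_l s l = t.+1.*2)%N by rewrite sum_lab_class -sum_support.
have inE' i : (0 < f i)%N -> i \in E.
  by move=> fi; apply/negPn/negP => /h1 e; rewrite e in fi.
have pos (P : pred 'I_n) : (0 < \sum_(i | P i) f i)%N -> exists2 i, P i & (0 < f i)%N.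
  rewrite lt0n sum_nat_eq0 negb_forall => /existsP[i].
  by rewrite negb_imply -lt0n => /andP[]; exists i.
have [i0 _ fi0] : exists2 i, true & (0 < f i)%N by apply: (pos predT); rewrite h2.
(* i is a support element whose class sum is maximal; j is chosen likewise outside the class of
   i. *)
have [i fi imax] := @arg_maxnP _ i0 (fun i => 0 < f i)%N (fun i => s (lab i)) fi0.
(* The class of i carries at most t+1 of the total 2t+2, so the support meets another class. *)
have [j0 /= hj0 fj0] : exists2 j, (j \in E) && (lab j != lab i) & (0 < f j)%N.
  apply: pos; have := h3 (lab i); move: h2; rewrite sum_support //.
  rewrite (bigID [pred j | lab j == lab i]) /=.
  have -> : (\sum_(k in E | lab k == lab i) f k = s (lab i))%N.
    by apply: eq_bigl => k; rewrite inE.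
  rewrite -/(s _); move: (\sum_(k in E | _) f k)%N => u; lia.
have pj0 : (0 < f j0)%N && (lab j0 != lab i) by rewrite fj0; case/andP: hj0.
have [j /andP[fj ji] jmax] :=
  @arg_maxnP _ j0 (fun j => (0 < f j)%N && (lab j != lab i)) (fun i => s (lab i)) pj0.
have ij : i != j by apply: contraNneq ji => ->.
exists i, j, (fun k => f k - (k \in [set i; j]%SET))%N.
have eqf k : f k = ((k \in [set i; j]%SET) + (f k - (k \in [set i; j]%SET)))%N.
  by rewrite subnKC // !inE; case: eqP => [->|_] //=; case: eqP => [->|].
split; rewrite ?inE' // 1?eq_sym //; apply/admissibleP; split.
- by move=> k /h1 ->.
- move: h2; rewrite (eq_bigr _ (fun k _ => eqf k)) big_split /=.
  by rewrite sum_nat_mem cards2 ij; lia.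
move=> l; have := h3 l; rewrite (eq_bigr _ (fun k _ => eqf k)) big_split /=.
set r := (\sum_(k in _) (f k - _))%N.
have two k : k \in lab_class l -> k \in [set i; j]%SET ->
    (0 < \sum_(k in lab_class l) (k \in [set i; j]%SET))%N.
  by move=> kl kij; rewrite (bigD1 k) //= kij.
have less x y : (0 < x)%N -> (x + y <= t.+1)%N -> (y <= t)%N by lia.
have [Ei|nl1] := eqVneq (lab i) l.
  by apply/less/(two i); rewrite !inE ?inE' // ?Ei !eqxx.
have [Ej|nl2] := eqVneq (lab j) l.
  by apply/less/(two j); rewrite !inE ?inE' // ?Ej !eqxx ?orbT.
have r_le : (r <= s l)%N by apply: leq_sum => k _; rewrite leq_subr.
(* A third class of sum at least t+1 would force the same for the classes of i and j by maximality,
   giving 3(t+1) > 2t+2. *)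
move=> _; apply: leq_trans r_le _; rewrite leqNgt; apply/negP => big.
have [k kl fk] : exists2 k, k \in lab_class l & (0 < f k)%N.
  by apply: pos; rewrite -/(s l); lia.
have lk : lab k = l by move: kl; rewrite inE => /andP[_ /eqP].
have m1 := imax j fj; have := jmax k; rewrite lk fk eq_sym nl1 => /(_ isT) m2.
move: ss; rewrite (bigD1 l) //= (bigD1 (lab i)) //= (bigD1 (lab j)) /=; last first.
  by rewrite nl2 ji.
by rewrite /= in m1 m2 *; lia.
Qed.

(** The integer decomposition property of the base polytope, by splitting off one base at a time. *)
Lemma admissible_decompose t f : admissible t f ->
  exists b : 'I_t -> {set 'I_n}, (forall k, b k \in transversal_pairs) /\
    forall i, f i = (\sum_k (i \in b k))%N.
Proof.
elim: t f => [|t IH] f.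
  move=> /admissibleP[_ /eqP]; rewrite sum_nat_eq0 => /forall_inP f0 _.
  by exists (fun=> finset.set0); split => [[]|i] //; rewrite big_ord0; exact/eqP/f0.
move=> /admissible_remove[i [j [g [iE jE ij /IH[b [hb gE]] fE]]]].
exists (fun k => if unlift ord0 k is Some k' then b k' else [set i; j]%SET); split.
  move=> k; case: (unlift ord0 k) => [k'|]; first exact: hb.
  by apply/transversal_pairsP; exists i, j.
move=> k; rewrite fE gE big_ord_recl unlift_none; congr (_ + _)%N.
by apply: eq_bigr => l _; rewrite liftK.
Qed.

End TransversalPairs.

Section LatticePoints.
Variables (R : realType) (n : nat).
Implicit Types (Bs : {set {set 'I_n}}) (c : 'I_n -> R).

Lemma indicatorE (B : {set 'I_n}) i : indicator R B 0 i = (i \in B)%:R.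
Proof.
rewrite /indicator summxE; have [iB|iB] := boolP (i \in B).
  rewrite (bigD1 i) //= mxE !eqxx big1 ?addr0 // => j /andP[_ ji].
  by rewrite mxE eqxx eq_sym (negPf ji).
by rewrite big1 // => j jB; rewrite mxE eqxx; case: eqP iB jB => // -> /negP.
Qed.

Lemma base_polytope_le Bs c k x : base_polytope R Bs x ->
  (forall B, B \in Bs -> \sum_(i in B) c i <= k) -> \sum_i x 0 i * c i <= k.
Proof.
move=> [m [w [v [hv w0 w1 ->]]]] hc.
have -> : \sum_i (\sum_j w j *: v j) 0 i * c i = \sum_j w j * \sum_i v j 0 i * c i.
  rewrite (eq_bigr (fun i => \sum_j w j * (v j 0 i * c i))); last first.
    by move=> i _; rewrite summxE mulr_suml; apply: eq_bigr => j _; rewrite mxE mulrA.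
  by rewrite exchange_big; apply: eq_bigr => j _; rewrite mulr_sumr.
rewrite -[k]mul1r -w1 mulr_suml ler_sum // => j _; rewrite ler_wpM2l //.
have [B BBs <-] := hv j; apply: le_trans (hc B BBs).
rewrite [leRHS]big_mkcond; apply: ler_sum => i _; rewrite indicatorE.
by case: (i \in B); rewrite ?mul1r ?mul0r.
Qed.

Variables (E : {set 'I_n}) (lab : 'I_n -> 'I_n).
Local Notation tp := (transversal_pairs E lab).

Lemma lattice_admissible t (z : 'rV[int]_n) :
  lattice_points (dilate t (base_polytope R tp)) z ->
  exists2 g : 'I_n -> nat, admissible E lab t g & z = \row_i (g i)%:Z.
Proof.
move=> [x hx zE].
have zx i : (z 0 i)%:~R = t%:R * x 0 i.
  by move/rowP: zE => /(_ i); rewrite !mxE => ->.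
(* Admissibility is tested on linear forms: minus a coordinate, the coordinate of a loop, plus or
   minus the sum of coordinates, and the sum over a class. *)
have bnd c k : (forall i j, i \in E -> j \in E -> lab i != lab j -> c i + c j <= k) ->
    \sum_i x 0 i * c i <= k.
  move=> hc; apply: base_polytope_le hx _ => B /transversal_pairsP[i [j [iE jE ij ->]]].
  by rewrite sum_pair ?hc //; apply: contraNneq ij => ->.
have x0 i : 0 <= x 0 i.
  have := @bnd (fun j => - (j == i)%:R) 0 _.
  rewrite (bigD1 i) //= eqxx big1 => [|j /negPf ->]; last by rewrite oppr0 mulr0.
  rewrite addr0 mulrN1 oppr_le0; apply => j k _ _ _.
  by rewrite -opprD oppr_le0 addr_ge0.
have xE i : i \notin E -> x 0 i = 0.
  move=> iE; apply/eqP; rewrite eq_le x0 andbT.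
  have := @bnd (fun j => (j == i)%:R) 0 _.
  rewrite (bigD1 i) //= eqxx big1 => [|j /negPf ->]; last by rewrite mulr0.
  rewrite addr0 mulr1; apply => j k jE kE _.
  have /negPf -> : j != i by apply: contraNneq iE => <-.
  have /negPf -> : k != i by apply: contraNneq iE => <-.
  by rewrite addr0.
have x2 : \sum_i x 0 i = 2.
  apply/eqP; rewrite eq_le; apply/andP; split.
    by have := @bnd (fun=> 1) 2 _; under eq_bigr do rewrite mulr1; apply.
  have := @bnd (fun=> -1) (-2) _; under eq_bigr do rewrite mulrN1.
  by rewrite sumrN lerN2; apply => *; rewrite -opprD.
have x1 l : \sum_(i in lab_class E lab l) x 0 i <= 1.
  have H : \sum_i x 0 i * (i \in lab_class E lab l)%:R <= 1.
    apply: bnd => i j iE jE ij; rewrite !inE iE jE /=.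
    have : ~~ ((lab i == l) && (lab j == l)).
      by apply: contraNN ij => /andP[/eqP -> /eqP ->].
    by case: (lab i == l); case: (lab j == l) => //= _; lra.
  apply: le_trans H; rewrite [leLHS]big_mkcond; apply: ler_sum => i _.
  by case: (i \in _); rewrite ?mulr1 ?mulr0.
have z0 i : 0 <= z 0 i by rewrite -(ler0z R) zx mulr_ge0.
have gx i : (absz (z 0 i))%:R = t%:R * x 0 i by rewrite -zx -[in RHS](gez0_abs (z0 i)).
exists (fun i => absz (z 0 i)); last by apply/rowP => i; rewrite mxE gez0_abs.
apply/admissibleP; split.
- by move=> i /xE xi; apply/eqP; rewrite -(eqr_nat R) gx xi mulr0.
- apply/eqP; rewrite -(eqr_nat R) natr_sum; under eq_bigr do rewrite gx.
  by rewrite -mulr_sumr x2 -mul2n natrM mulrC.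
- move=> l; rewrite -(ler_nat R) natr_sum; under eq_bigr do rewrite gx.
  by rewrite -mulr_sumr -[leRHS]mulr1 ler_wpM2l.
Qed.

Lemma admissible_lattice t (g : 'I_n -> nat) :
  (exists B, B \in tp) -> admissible E lab t g ->
  lattice_points (dilate t (base_polytope R tp)) (\row_i (g i)%:Z).
Proof.
move=> [B0 hB0] /admissible_decompose[b [hb gE]].
(* At t = 0 there are no indicators to average, and any point of the polytope serves; this is where
   [B0] is used. *)
case: t b hb gE => [|t] b hb gE.
  exists (indicator R B0).
    exists 1%N, (fun=> 1), (fun=> indicator R B0); split => //.
    - by move=> _; exists B0.
    - by rewrite big_ord1.
    - by rewrite big_ord1 scale1r.
  by apply/rowP => i; rewrite !mxE gE big_ord0 mul0r.
exists (\sum_k t.+1%:R^-1 *: indicator R (b k)).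
  exists t.+1, (fun=> t.+1%:R^-1), (fun k => indicator R (b k)); split => //.
  - by move=> k; exists (b k) => //; apply: hb.
  - by move=> _; rewrite invr_ge0 ler0n.
  - by rewrite sumr_const card_ord -[t.+1%:R^-1 *+ _]mulr_natr mulVf ?pnatr_eq0.
apply/rowP => i; rewrite !mxE gE summxE mulr_sumr -pmulrn natr_sum.
by apply: eq_bigr => k _; rewrite mxE indicatorE mulVKf ?pnatr_eq0.
Qed.

End LatticePoints.

(* The coefficient of X^p Y^q in (1 + X + ... + X^W)^|S| (1 + Y + ... + Y^W)^|S'|. *)
Lemma card_two_sums (I : finType) (S S' : {set I}) (W p q : nat) :
  [disjoint S & S'] -> (p <= W)%N -> (q <= W)%N ->
  #|[set f : {ffun I -> 'I_W.+1} |
      [&& [forall (i | i \notin S :|: S'), f i == 0%N :> nat],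
          (\sum_(i in S) f i)%N == p & (\sum_(i in S') f i)%N == q]]%SET|
  = (wcomp #|S| p * wcomp #|S'| q)%N.
Proof.
move=> dis hp hq.
(* X is the outer and Y the inner indeterminate: indices in S give X^j, those in S' give Y^j, and
   all others force j = 0. *)
pose g i (j : 'I_W.+1) : {poly {poly nat}} := if i \in S then 'X^j else
  if i \in S' then ('X^j)%:P else (j == 0%N :> nat)%:R.
pose A : {poly nat} := \sum_(j < W.+1) 'X^j.
have SS' i : i \in S' -> (i \in S) = false.
  by move=> iS'; apply: (disjointFl dis).
have split3 (F : I -> {poly {poly nat}}) : \prod_i F i =
    \prod_(i in S) F i * \prod_(i in S') F i * \prod_(i | i \notin S :|: S') F i.
  rewrite (bigID (mem S)) /= -mulrA; congr (_ * _).
  rewrite (bigID (mem S')) /=; congr (_ * _); apply: eq_bigl => i.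
    by case: (boolP (i \in S')) => [/SS' ->|]; rewrite ?andbF.
  by rewrite inE negb_or.
have lhs : \prod_i \sum_j g i j = map_poly polyC (A ^+ #|S|) * (A ^+ #|S'|)%:P.
  rewrite split3 [X in _ * X]big1 ?mulr1; last first.
    move=> i; rewrite inE negb_or => /andP[/negPf iS /negPf iS'].
    rewrite (bigD1 ord0) //= /g iS iS' eqxx big1 ?addr0 // => j j0.
    by case: eqP => // e; case/eqP: j0; apply: val_inj.
  congr (_ * _).
    rewrite rmorphXn /= -prodr_const; apply: eq_bigr => i iS.
    rewrite rmorph_sum; apply: eq_bigr => j _.
    by rewrite /g iS /= rmorphXn /= map_polyX.
  rewrite rmorphXn /= -prodr_const; apply: eq_bigr => i iS'.
  rewrite rmorph_sum; apply: eq_bigr => j _.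
  by rewrite /g SS' // iS'.
have := lhs; rewrite bigA_distr_bigA /= => /(congr1 (fun r : {poly {poly nat}} => (r`_p)`_q)).
rewrite coefMC coef_map /= coefCM !coef_geometric // => H; apply: etrans H.
rewrite !coef_sum -sum1_card big_mkcond /=; apply: eq_bigr => f _.
rewrite inE split3; case: (boolP [forall (i | i \notin S :|: S'), f i == 0%N :> nat]) => [/forall_inP h|].
  rewrite [X in _ * X]big1 ?mulr1; last first.
    move=> i hi; rewrite /g h //; move: hi.
    by rewrite inE negb_or => /andP[/negPf -> /negPf ->].
  rewrite (eq_bigr (fun i => 'X ^+ f i)); last by move=> i iS; rewrite /g iS.
  rewrite [X in _ * X](eq_bigr (fun i => ('X ^+ f i)%:P)); last first.
    by move=> i iS'; rewrite /g SS' // iS'.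
  rewrite -rmorph_prod /= !prodrXr coefMC coefXn mulr_natl coefMn coefXn.
  by rewrite eq_sym [_ == q]eq_sym; case: (p == _); case: (q == _).
rewrite negb_forall => /existsP[i]; rewrite negb_imply => /andP[hi fi].
have gi : g i (f i) = 0.
  by move: hi; rewrite /g inE negb_or => /andP[/negPf -> /negPf ->]; rewrite (negPf fi).
by rewrite [X in _ * X](bigD1 i) //= gi mul0r mulr0 !coef0.
Qed.

(** * Counting admissible vectors by excluding heavy classes *)

Section CountLatticePoints.
Variables (R : realType) (n : nat) (E : {set 'I_n}) (lab : 'I_n -> 'I_n).
Local Notation cls := (lab_class E lab).

Definition ehrhart_poly (m : nat) (a : 'I_n -> nat) : {poly R} :=
  psum (layer R m.-1) m - \sum_l psum (layer R m.-1) (a l).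

Lemma lab_class_sub l : cls l \subset E.
Proof. by apply/fintype.subsetP => i; rewrite inE => /andP[]. Qed.

(** Bounding the entries by W yields a finite type and loses nothing, as natural numbers of sum W
    never exceed W. *)
Let supp W : {set {ffun 'I_n -> 'I_W.+1}} :=
  [set f : {ffun 'I_n -> 'I_W.+1} | [forall (i | i \notin E), f i == 0%N :> nat] & (\sum_(i in E) f i)%N == W]%SET.

Let heavy (t : nat) (l : 'I_n) : {set {ffun 'I_n -> 'I_t.*2.+1}} :=
  [set f in supp t.*2 | (t < \sum_(i in cls l) f i)%N]%SET.

Lemma card_supp W : #|supp W| = wcomp #|E| W.
Proof.
have := @card_two_sums _ E finset.set0 W W 0; rewrite cards0 wcompk0 muln1 => <- //.
  by apply: eq_card => f; rewrite !inE finset.setU0 big_set0 eqxx andbT.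
by rewrite -setI_eq0 finset.setI0.
Qed.

(** Sorted by the excess r+1 of the class sum over t; each stratum prescribes the sums on the class
    and on the rest of E. *)
Lemma card_heavy t l : #|heavy t l| =
  (\sum_(r < t) wcomp #|cls l| (t + r.+1) * wcomp (#|E| - #|cls l|) (t - r.+1))%N.
Proof.
have -> : #|heavy t l| = (\sum_(r < t)
    #|[set f in supp t.*2 | (\sum_(i in cls l) f i)%N == (t + r.+1)%N]%SET|)%N.
  under [RHS]eq_bigr => r _ do rewrite -sum1_card big_mkcond.
  rewrite exchange_big -sum1_card big_mkcond /=; apply: eq_bigr => f _.
  rewrite [in LHS]inE; case: ifP => [/andP[hf hl]|nf].
    have hs : ((\sum_(i in cls l) f i - t.+1) < t)%N.
      move: hf; rewrite inE => /andP[_ /eqP hf].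
      have := hf; rewrite (big_setID (cls l)) /= (finset.setIidPr (lab_class_sub l)).
      move: hl; move: (\sum_(i in cls l) f i)%N => x; lia.
    rewrite (bigD1 (Ordinal hs)) //= inE hf /= subnSK // subnKC ?(ltnW hl) // eqxx big1 //.
    move=> r nr; rewrite inE hf /=; case: eqP => // e; case/eqP: nr; apply: val_inj => /=.
    by rewrite e; lia.
  rewrite big1 // => r _; rewrite inE; case: ifP => // /andP[hf /eqP e].
  by move: nf; rewrite hf e /= addnS ltnS leq_addr.
apply: eq_bigr => r _; have hr := ltn_ord r.
have cE := lab_class_sub l.
rewrite -[(#|E| - _)%N]cardsDS // -(@card_two_sums _ _ _ t.*2); last first.
- by lia.
- by lia.
- rewrite -setI_eq0; apply/eqP/setP => i; rewrite !inE.
  by case: (i \in E) => //=; case: (lab i == l).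
have U : cls l :|: (E :\: cls l) = E.
  by apply/setP => i; rewrite !inE; case: (i \in E) => //=; case: (lab i == l).
apply: eq_card => f; rewrite inE [in LHS]inE [RHS]inE U.
rewrite [X in _ && (X == t.*2)](big_setID (cls l)) /= (finset.setIidPr cE).
rewrite -andbA; congr (_ && _).
move: (\sum_(i in cls l) f i)%N (\sum_(i in E :\: cls l) f i)%N => x y.
by apply/andP/andP => -[/eqP h1 /eqP h2]; split; apply/eqP; lia.
Qed.

(** Each vector of [supp] is either admissible or heavy for exactly one class, since two class sums
    above t would exceed 2t. *)
Lemma card_admissible t :
  (#|[set f : {ffun 'I_n -> 'I_t.*2.+1} | admissible E lab t (fun i => f i)]%SET| +
   \sum_l #|heavy t l|)%N = wcomp #|E| t.*2.
Proof.
rewrite -card_supp; under eq_bigr => l _ do rewrite -sum1_card big_mkcond.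
rewrite -!sum1_card exchange_big /= big_mkcond [RHS]big_mkcond -big_split /=; apply: eq_bigr => f _.
have [hs|hs] := boolP (f \in supp t.*2); last first.
  rewrite big1 => [|l _]; last by rewrite inE (negPf hs).
  rewrite inE; case: admissibleP => // -[h1 h2 _]; case/negP: hs; rewrite inE.
  rewrite -(@sum_support _ E (fun i => f i) h1) h2 eqxx andbT; apply/forall_inP => i iE.
  by rewrite h1.
have [h1 h2] : (forall i, i \notin E -> f i = 0%N :> nat) /\ (\sum_(i in E) f i)%N = t.*2.
  move: hs; rewrite inE => /andP[/forall_inP h1 /eqP h2]; split => // i iE.
  exact/eqP/h1.
rewrite inE; case: admissibleP => [[_ _ h3]|na].
  by rewrite big1 // => l _; rewrite inE ltnNge h3 andbF.
have [l hl] : exists l, (t < \sum_(i in cls l) f i)%N.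
  case: (boolP [exists l, (t < \sum_(i in cls l) f i)%N]) => [/existsP //|/existsPn h].
  case: na; split => //.
    by rewrite (@sum_support _ E (fun i => f i) h1).
  by move=> l; rewrite leqNgt.
rewrite (bigD1 l) //= inE hs hl big1 // => k kl; rewrite inE hs /= ltnNge.
suff -> : (\sum_(i in cls k) f i <= t)%N by [].
have : (\sum_(i in cls l) f i + \sum_(i in cls k) f i <= t.*2)%N.
  apply: leq_trans (eq_leq h2).
  rewrite -(sum_lab_class E lab) [leqRHS](bigD1 l) //= [X in (_ <= _ + X)%N](bigD1 k) //=.
  by rewrite addnA leq_addr.
move: hl; move: (\sum_(i in cls l) f i)%N (\sum_(i in cls k) f i)%N => x y.
by lia.
Qed.

Lemma ehrhart_poly_nat t : (0 < #|E|)%N -> (forall l, (#|cls l| < #|E|)%N) ->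
  (ehrhart_poly #|E| (fun l => #|cls l|)).[t%:R] =
  #|[set f : {ffun 'I_n -> 'I_t.*2.+1} | admissible E lab t (fun i => f i)]%SET|%:R.
Proof.
move=> E0 pr; have [N m0] : exists N, #|E| = N.+1 by exists #|E|.-1; lia.
have H := card_admissible t; rewrite m0 in H *; rewrite hornerD hornerN /psum !horner_sum sum_layer_nat -H natrD natr_sum.
apply/eqP; rewrite subr_eq; apply/eqP; congr (_ + _).
apply: eq_bigr => l _; rewrite horner_sum psum_layer_nat ?card_heavy ?m0 //.
by rewrite -ltnS -m0.
Qed.

End CountLatticePoints.

(** * Ehrhart coefficients *)

Section EhrhartTransversal.
Variables (R : realType) (n : nat) (E : {set 'I_n}) (lab : 'I_n -> 'I_n).
Local Notation cls := (lab_class E lab).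
Local Notation tp := (transversal_pairs E lab).
Variables (i0 j0 : 'I_n).
Hypotheses (i0E : i0 \in E) (j0E : j0 \in E) (ij0 : lab i0 != lab j0).

Lemma tp_mem0 : [set i0; j0]%SET \in tp.
Proof. by apply/transversal_pairsP; exists i0, j0. Qed.

Lemma lab_class_proper l : (#|cls l| < #|E|)%N.
Proof.
apply: proper_card; rewrite properE lab_class_sub.
apply/fintype.subsetPn; have [e|ne] := eqVneq (lab i0) l.
  by exists j0; rewrite // inE j0E -e eq_sym.
by exists i0; rewrite // inE i0E.
Qed.

Lemma card_lattice_points t :
  (lattice_points (dilate t (base_polytope R tp)) #=
   `I_#|[set f : {ffun 'I_n -> 'I_t.*2.+1} | admissible E lab t (fun i => f i)]%SET|)%card.
Proof.
set D := [set f | _]%SET.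
pose F (k : nat) : 'rV[int]_n :=
  \row_i (nth [ffun=> ord0] (enum D) k i : nat)%:Z.
have -> : lattice_points (dilate t (base_polytope R tp)) = [set F k | k in `I_#|D|]%classic.
  apply/seteqP; split => z /=.
    move=> /lattice_admissible[g hg ->].
    have glt i : (g i < t.*2.+1)%N.
      by have /admissibleP[_ <- _] := hg; rewrite ltnS (bigD1 i) //= leq_addr.
    pose f : {ffun 'I_n -> 'I_t.*2.+1} := [ffun i => Ordinal (glt i)].
    have fD : f \in D.
      by rewrite inE; have -> // : (fun i => f i : nat) = g by apply/funext => i; rewrite ffunE.
    exists (index f (enum D)); first by rewrite /= cardE index_mem mem_enum.
    by apply/rowP => i; rewrite !mxE nth_index ?mem_enum // ffunE.
  move=> [k hk <-]; apply: admissible_lattice; first by exists [set i0; j0]%SET; exact: tp_mem0.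
  have : nth [ffun=> ord0] (enum D) k \in D by rewrite -mem_enum mem_nth -?cardE.
  by rewrite inE.
apply: inj_card_eq => k l; rewrite !inE /= !cardE => hk hl /rowP e.
apply/eqP; rewrite -(nth_uniq [ffun=> ord0] hk hl) ?enum_uniq //.
apply/eqP/ffunP => i; apply: val_inj; have := e i; rewrite !mxE => -[].
by [].
Qed.

Lemma ehr_transversal :
  ehr (base_polytope R tp) = ehrhart_poly R #|E| (fun l => #|cls l|).
Proof.
have h : is_ehrhart (base_polytope R tp) (ehrhart_poly R #|E| (fun l => #|cls l|)).
  move=> t; exists #|[set f : {ffun 'I_n -> 'I_t.*2.+1} | admissible E lab t (fun i => f i)]%SET|.
    exact: card_lattice_points.
  apply: ehrhart_poly_nat; last exact: lab_class_proper.
  by apply/card_gt0P; exists i0.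
rewrite /ehr; case: xgetP => [p _ hp|/(_ _ h)//].
exact: is_ehrhart_inj hp h.
Qed.

Lemma coef_ehr_transversal j :
  let d i := (layer R #|E|.-1 i)`_j in
  (ehr (base_polytope R tp))`_j = psum d #|E| - \sum_l psum d #|cls l|.
Proof.
rewrite ehr_transversal /ehrhart_poly coefB coef_sum /psum coef_sum; congr (_ - _).
by apply: eq_bigr => l _; rewrite coef_sum.
Qed.

Lemma sum_card_lab_class : (\sum_l #|cls l| = #|E|)%N.
Proof.
rewrite -sum1_card -(sum_lab_class E lab); apply: eq_bigr => l _.
by rewrite sum1_card.
Qed.

Lemma lab_class_gt0 i : i \in E -> (0 < #|cls (lab i)|)%N.
Proof. by move=> iE; apply/card_gt0P; exists i; rewrite inE iE eqxx. Qed.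

Lemma card_E : #|E| = #|E|.-1.+1.
Proof. by rewrite prednK //; apply/card_gt0P; exists i0. Qed.

Let sum_card : (\sum_l #|cls l| = #|E|.-1.+1)%N.
Proof. by rewrite sum_card_lab_class -card_E. Qed.

Let layer_coef_le j i i' : (i < i')%N -> (i + i' <= #|E|.-1)%N ->
  (layer R #|E|.-1 i)`_j <= (layer R #|E|.-1 i')`_j.
Proof. exact: layer_le. Qed.

(** Degree |E|-1 is left out because its coefficient vanishes when there are only two classes;
    [ehr_gt0_top] reaches it from a third class. *)
Lemma ehr_gt0 j : (j < #|E|.-1)%N -> 0 < (ehr (base_polytope R tp))`_j.
Proof.
move=> hj; rewrite coef_ehr_transversal subr_gt0 [X in psum _ X]card_E.
exact: (psum_family_lt_total (layer_coef_le j) sum_card (layer0_lt_layerN _ hj) ij0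
  (lab_class_gt0 i0E) (lab_class_gt0 j0E)).
Qed.

Variable k0 : 'I_n.
Hypotheses (k0E : k0 \in E) (ki0 : lab k0 != lab i0) (kj0 : lab k0 != lab j0).

Let uniq3 : uniq [:: lab i0; lab j0; lab k0].
Proof. by rewrite /= !inE negb_or ij0 eq_sym ki0 eq_sym kj0. Qed.

Let all3 : all (fun l => 0 < #|cls l|)%N [:: lab i0; lab j0; lab k0].
Proof. by rewrite /= !lab_class_gt0. Qed.

Lemma ehr_gt0_top j : (1 <= j <= #|E|.-1)%N -> 0 < (ehr (base_polytope R tp))`_j.
Proof.
move=> hj; rewrite coef_ehr_transversal subr_gt0 [X in psum _ X]card_E.
apply: (psum_family_lt_total3 (layer_coef_le j) sum_card _ uniq3 all3).
by move=> i i' h1 h2; apply: layer_lt.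
Qed.

(* The right-hand sides are the coefficients of the Ehrhart polynomials of the
   uniform and of the minimal matroid. *)
Lemma ehr_le_uniform j : let d i := (layer R #|E|.-1 i)`_j in
  (ehr (base_polytope R tp))`_j <= psum d #|E| - psum d 1 *+ #|E|.
Proof.
rewrite /= coef_ehr_transversal lerD2l lerN2 [X in _ *+ X]card_E.
exact: (psum_family_ge (layer_coef_le j) sum_card).
Qed.

Lemma ehr_lt_uniform j x y : let d i := (layer R #|E|.-1 i)`_j in
  x \in E -> y \in E -> x != y -> lab x = lab y -> (1 <= j <= #|E|.-1)%N ->
  (ehr (base_polytope R tp))`_j < psum d #|E| - psum d 1 *+ #|E|.
Proof.
move=> d xE yE xy lxy hj; rewrite coef_ehr_transversal ltrD2l ltrN2 [X in _ *+ X]card_E.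
have h1 : (1 < #|cls (lab x)|)%N.
  by apply/card_gt1P; exists x, y; rewrite ?inE ?xE ?yE ?lxy ?eqxx.
have [i iE hi] : exists2 i, i \in E & lab x != lab i.
  have [e|ne] := eqVneq (lab x) (lab i0); last by exists i0.
  by exists j0; rewrite // e.
apply: (psum_family_gt (layer_coef_le j) sum_card _ hi h1 (lab_class_gt0 iE)).
by move=> ? ? ? ?; apply: layer_lt.
Qed.

Lemma ehr_ge_minimal j : let d i := (layer R #|E|.-1 i)`_j in
  psum d #|E| - (psum d 1 + psum d 1 + psum d #|E|.-2) <= (ehr (base_polytope R tp))`_j.
Proof.
rewrite /= coef_ehr_transversal lerD2l lerN2.
exact: (psum_family_le (layer_coef_le j) sum_card uniq3 all3).
Qed.

Lemma ehr_gt_minimal j : let d i := (layer R #|E|.-1 i)`_j in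
  (1 <= j <= #|E|.-1)%N ->
  (forall l l', #|cls l| = 1%N -> #|cls l'| = 1%N -> l != l' ->
    exists k k', [/\ uniq [:: l; l'; k; k'], (0 < #|cls k|)%N & (0 < #|cls k'|)%N]) ->
  psum d #|E| - (psum d 1 + psum d 1 + psum d #|E|.-2) < (ehr (base_polytope R tp))`_j.
Proof.
move=> d hj no; rewrite coef_ehr_transversal ltrD2l ltrN2.
apply: (psum_family_lt (layer_coef_le j) sum_card _ uniq3 all3 no).
by move=> ? ? ? ?; apply: layer_lt.
Qed.

End EhrhartTransversal.

(** * Matroids of rank two *)

Section MatroidLabels.

(** Induction on the size of A minus B: an exchange keeps the size of A and brings it one element
    closer to B. *)
Lemma matroid_bases_card (T : finType) (S : {set T}) (M : matroid S) A B :
  A \in bases M -> B \in bases M -> #|A| = #|B|.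
Proof.
have [_ _ ex] := matroidP M.
suff H k : forall A B, #|A :\: B| = k -> A \in bases M -> B \in bases M -> (#|A| <= #|B|)%N.
  by move=> hA hB; apply/eqP; rewrite eqn_leq !(H _ _ _ erefl).
elim: k => [|k IH] {}A {}B.
  by move=> /cards0_eq/eqP; rewrite finset.setD_eq0 => /subset_leq_card.
move=> hk hA hB; have [a haAB] : exists a, a \in A :\: B.
  by apply/card_gt0P; rewrite hk.
have [b] := ex _ _ _ hA hB haAB; rewrite inE => /andP[bA bB] hA'.
move: (haAB); rewrite inE => /andP[aB aA].
have cA : #|b |: (A :\ a)| = #|A|.
  by rewrite cardsU1 !inE (negPf bA) andbF (cardsD1 a A) aA.
rewrite -cA; apply: IH => //.
have -> : (b |: (A :\ a)) :\: B = (A :\: B) :\ a.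
  apply/setP => x; rewrite !inE; have [->|_] := eqVneq x b; last by rewrite /= andbCA.
  by rewrite bB /= andbF.
by move: hk; rewrite (cardsD1 a) haAB => -[].
Qed.

Variables (n : nat) (M : matroid [set: 'I_n]%SET).
Hypothesis rank2 : matroid_rank M = 2%N.
Implicit Types (i j k : 'I_n).

Lemma rank2_card B : B \in bases M -> #|B| = 2%N.
Proof.
move=> hB; have h0 : (0 < #|bases M|)%N by apply/card_gt0P; exists B.
have [A hA eA] := eq_bigmax_cond (fun B : {set 'I_n} => #|B|) h0.
by rewrite (matroid_bases_card hB hA) -eA.
Qed.

Lemma rank2_labels : exists (E : {set 'I_n}) (lab : 'I_n -> 'I_n) (i0 j0 : 'I_n),
  [/\ bases M = transversal_pairs E lab, i0 \in E, j0 \in E & lab i0 != lab j0].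
Proof.
have [/set0Pn[B0 hB0] _ ex] := matroidP M.
pose adj i j := [set i; j]%SET \in bases M.
pose E := [set i | [exists j, adj i j]]%SET.
have adjC i j : adj i j = adj j i by rewrite /adj finset.setUC.
have adjE i j : adj i j -> i \in E by move=> h; rewrite inE; apply/existsP; exists j.
have adj_ne i j : adj i j -> i != j.
  by move=> /rank2_card; rewrite cards2; case: (i != j).
(* Transitivity of parallelism, contraposed: in a base {j, l} the element l is exchanged against {i,
   k}. *)
have tri i j k : adj i k -> j \in E -> adj i j || adj k j.
  move=> hik; rewrite inE => /existsP[l hjl].
  have [->|li] := eqVneq i l; first by rewrite adjC hjl.
  have [->|lk] := eqVneq k l; first by rewrite orbC adjC hjl.
  have hl : l \in [set j; l]%SET :\: [set i; k]%SET.
    by rewrite !inE eqxx orbT andbT negb_or eq_sym li eq_sym lk.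
  have [b] := ex _ _ _ hjl hik hl; rewrite !inE negb_or => /andP[/andP[bj bl] bik].
  have -> : ([set j; l]%SET :\ l) = [set j]%SET.
    apply/setP => x; rewrite !inE; have [->|_] := eqVneq x l; last by rewrite orbF.
    by rewrite eq_sym (negPf (adj_ne _ _ hjl)).
  by case/orP: bik => /eqP ->; rewrite -/(adj _ _) => ->; rewrite ?orbT.
(* A canonical element parallel to i: [pick] depends only on the predicate, so parallel elements
   receive the same label. *)
pose lab i := odflt i [pick k in E | ~~ adj i k].
have adjii i : ~~ adj i i by apply/negP => /adj_ne; rewrite eqxx.
have labP i : i \in E -> (lab i \in E) && ~~ adj i (lab i).
  by move=> iE; rewrite /lab; case: pickP => [k //|/(_ i)]; rewrite iE adjii.
have labE i j : i \in E -> j \in E -> adj i j = (lab i != lab j).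
  move=> iE jE; apply/idP/idP => [hij|].
    apply/negP => /eqP e; have /andP[kE ki] := labP _ iE; have /andP[_ kj] := labP _ jE.
    by have := tri _ _ _ hij kE; rewrite (negPf ki) e (negPf kj).
  apply: contraR => nij; rewrite /lab.
  have -> : [pick k in E | ~~ adj i k] = [pick k in E | ~~ adj j k].
    apply: eq_pick => k /=; case kE : (k \in E) => //=; congr negb.
    apply/idP/idP => h.
      by have := tri _ _ _ h jE; rewrite (negPf nij) adjC.
    by have := tri _ _ _ h iE; rewrite adjC (negPf nij) adjC.
  by case: pickP => [k //|/(_ j)]; rewrite jE adjii.
have cE i j : [set i; j]%SET \in bases M -> [/\ i \in E, j \in E & lab i != lab j].
  move=> h; have iE := adjE i j h; have jE : j \in E by apply: (adjE j i); rewrite adjC.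
  by split=> //; rewrite -labE.
have c2 B : B \in bases M -> exists i j, B = [set i; j]%SET.
  by move=> /rank2_card/eqP/cards2P[i [j [_ ->]]]; exists i, j.
have [i0 [j0 e0]] := c2 _ hB0; have := hB0; rewrite e0 => /cE[i0E j0E ij0].
exists E, lab, i0, j0; split => //; apply/setP => B; apply/idP/transversal_pairsP.
  by move=> hB; have [i [j e]] := c2 _ hB; move: hB; rewrite e => /cE[? ? ?]; exists i, j.
by move=> [i [j [iE jE ij ->]]]; rewrite -/(adj i j) labE.
Qed.

End MatroidLabels.

(** * Consequences of connectivity *)

Section Connectivity.
Variables (n : nat) (E : {set 'I_n}) (lab : 'I_n -> 'I_n).
Variable M : matroid [set: 'I_n]%SET.
Hypotheses (ME : bases M = transversal_pairs E lab) (Mc : connected_matroid M).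
Variables (i0 j0 : 'I_n).
Hypotheses (i0E : i0 \in E) (j0E : j0 \in E) (ij0 : lab i0 != lab j0).

(** A loop x would split off as a rank 0 summand on {x}, which is proper because i0 is not a
    loop. *)
Lemma connected_loopless : E = [set: 'I_n]%SET.
Proof.
apply/setP => x; rewrite [RHS]inE; apply/negPn/negP => xE; apply: Mc.
have loop B : B \in bases M -> x \notin B.
  rewrite ME => /transversal_pairsP[i [j [iE jE _ ->]]].
  by rewrite !inE negb_or; apply/andP; split; apply: contraNneq xE => ->.
have [Mn0 Msub Mex] := matroidP M.
have h1 : is_matroid [set x]%SET [set (finset.set0 : {set 'I_n})]%SET.
  split; first by apply/set0Pn; exists finset.set0; rewrite inE.
    by move=> B; rewrite inE => /eqP ->; exact: finset.sub0set.
  by move=> A B a; rewrite !inE => /eqP -> /eqP ->; rewrite inE andbF.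
have h2 : is_matroid (~: [set x])%SET (bases M).
  split=> // B hB; apply/fintype.subsetP => y yB; rewrite !inE.
  by apply: contraTneq yB => ->; exact: loop.
exists [set x]%SET, (~: [set x])%SET, (Matroid h1), (Matroid h2); split => //=.
- exact: finset.setUCr.
- by rewrite -setI_eq0 finset.setICr.
- rewrite properT; apply/eqP => e.
  have : i0 \in [set x]%SET by rewrite e inE.
  by rewrite inE => /eqP e'; rewrite -e' i0E in xE.
- rewrite properT; apply/eqP => e; have : x \in (~: [set x])%SET by rewrite e inE.
  by rewrite !inE eqxx.
apply/setP => B; apply/idP/imset2P => [hB|[B1 B2 hB1 hB2 ->]].
  by exists finset.set0 B; rewrite ?inE // finset.set0U.
by move: hB1; rewrite inE => /eqP ->; rewrite finset.set0U.
Qed.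

(** The rank 1 uniform matroid, used as the summand on a parallel class. *)
Lemma singletons_matroid (S : {set 'I_n}) x : x \in S ->
  is_matroid S [set [set y]%SET | y in S]%SET.
Proof.
move=> xS; split.
- by apply/set0Pn; exists [set x]%SET; apply: imset_f.
- by move=> B /imsetP[y yS ->]; rewrite finset.sub1set.
move=> A B a /imsetP[y yS ->] /imsetP[z zS ->]; rewrite !inE => /andP[az /eqP ay].
exists z; first by rewrite !inE eqxx andbT eq_sym -ay.
by rewrite ay finset.setDv finset.setU0; apply: imset_f.
Qed.

(** With only two parallel classes, M would be the direct sum of the rank 1 uniform matroids on
    them. *)
Lemma connected_third : exists k0, lab k0 != lab i0 /\ lab k0 != lab j0.
Proof.
have ET := connected_loopless.
case: (boolP [exists k, (lab k != lab i0) && (lab k != lab j0)]).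
  by move=> /existsP[k /andP[]]; exists k.
move=> /existsPn two; case: Mc.
have i0S : i0 \in lab_class E lab (lab i0) by rewrite inE i0E eqxx.
have j0S : j0 \in lab_class E lab (lab j0) by rewrite inE j0E eqxx.
exists (lab_class E lab (lab i0)), (lab_class E lab (lab j0)),
  (Matroid (singletons_matroid i0S)), (Matroid (singletons_matroid j0S)); split => /=.
- apply/setP => x; rewrite !inE ET inE /=.
  by have := two x; rewrite negb_and !negbK.
- rewrite -setI_eq0; apply/eqP/setP => x; rewrite !inE.
  apply/negP => /andP[/andP[_ /eqP e1] /andP[_ /eqP e2]].
  by move: ij0; rewrite -e1 -e2 eqxx.
- rewrite properT; apply/eqP => e; have : j0 \in lab_class E lab (lab i0) by rewrite e inE.
  by rewrite inE eq_sym (negPf ij0) andbF.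
- rewrite properT; apply/eqP => e; have : i0 \in lab_class E lab (lab j0) by rewrite e inE.
  by rewrite inE (negPf ij0) andbF.
rewrite ME; apply/setP => B; apply/transversal_pairsP/imset2P.
  move=> [i [j [iE jE ij ->]]].
  have := two i; have := two j; rewrite !negb_and !negbK => dj di.
  have [ei|ni] := eqVneq (lab i) (lab i0).
    have [ej|nj] := eqVneq (lab j) (lab i0); first by rewrite ei ej eqxx in ij.
    rewrite (negPf nj) /= in dj.
    by exists [set i]%SET [set j]%SET => //; apply: imset_f; rewrite inE ?iE ?jE ?ei ?eqxx ?dj.
  rewrite (negPf ni) /= in di; have ej : lab j == lab i0.
    by case/orP: dj => // ej; rewrite (eqP ej) (eqP di) eqxx in ij.
  exists [set j]%SET [set i]%SET; last by rewrite finset.setUC.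
    by apply: imset_f; rewrite inE jE ej.
  by apply: imset_f; rewrite inE iE di.
move=> [B1 B2 /imsetP[i hi ->] /imsetP[j hj ->] ->]; exists i, j.
move: hi hj; rewrite !inE => /andP[-> /eqP ->] /andP[-> /eqP ->].
by split.
Qed.

End Connectivity.

(** * The uniform and the minimal matroid *)

Section UniformMinimal.
Variables (R : realType) (n : nat).
Local Notation T := [set: 'I_n]%SET.

Lemma U2_transversal : U2 n = transversal_pairs T id.
Proof.
apply/setP => B; rewrite inE; apply/cards2P/transversal_pairsP.
  by move=> [i [j [ij ->]]]; exists i, j; rewrite !inE.
by move=> [i [j [_ _ ij ->]]]; exists i, j.
Qed.

Lemma coef_ehr_U2 j : (1 < n)%N -> let d i := (layer R n.-1 i)`_j in
  (ehr (base_polytope R (U2 n)))`_j = psum d n - psum d 1 *+ n.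
Proof.
move=> n1; rewrite /= U2_transversal.
rewrite (@coef_ehr_transversal _ _ _ _ (Ordinal (ltnW n1)) (Ordinal n1)) ?inE //.
rewrite cardsT card_ord; congr (_ - _).
rewrite (eq_bigr (fun=> psum (fun i => (layer R n.-1 i)`_j) 1)) ?sumr_const ?card_ord // => l _.
congr psum; suff -> : lab_class T id l = [set l]%SET by rewrite cards1.
by apply/setP => i; rewrite !inE.
Qed.

Hypothesis n3 : (2 < n)%N.
Let o0 : 'I_n := Ordinal (ltnW (ltnW n3)).
Let o1 : 'I_n := Ordinal (ltnW n3).
Let o2 : 'I_n := Ordinal n3.
(** Classes of sizes 1, 1, n-2: the first two elements are alone and all others are parallel. *)
Let labT (i : 'I_n) := if (i < 2)%N then i else o2.

Lemma T2_transversal : T2 n = transversal_pairs T labT.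
Proof.
apply/setP => B; rewrite in_T2; last exact: ltnW.
apply/andP/transversal_pairsP => [[cB /existsP[i /andP[iB i2]]]|].
  have /cards1P[j Ej] : #|B :\ i| == 1%N.
    by move: cB; rewrite (cardsD1 i) iB.
  have ji : j != i by have : j \in B :\ i by [rewrite Ej inE]; rewrite !inE => /andP[].
  exists i, j; split; rewrite ?inE //; last by rewrite -(finset.setD1K iB) Ej.
  rewrite /labT i2; case: ltnP => _; first by rewrite eq_sym.
  by apply: contraTneq i2 => ->.
move=> [i [j [_ _ ij ->]]]; rewrite cards2.
have -> : i != j by apply: contraNneq ij => ->.
split => //; have [i2|i2] := ltnP i 2.
  by apply/existsP; exists i; rewrite !inE eqxx.
apply/existsP; exists j; rewrite !inE eqxx orbT /=; rewrite ltnNge; apply: contraNN ij => j2.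
by rewrite /labT (ltnNge i) (ltnNge j) i2 j2 eqxx.
Qed.

Lemma coef_ehr_T2 j : let d i := (layer R n.-1 i)`_j in
  (ehr (base_polytope R (T2 n)))`_j = psum d n - (psum d 1 + psum d 1 + psum d n.-2).
Proof.
rewrite /= T2_transversal; set d := fun i => _.
rewrite (@coef_ehr_transversal _ _ _ _ o0 o1) ?inE // cardsT card_ord -/d; congr (_ - _).
have ne1 : o1 != o0 by [].
have ne2 : (o2 != o0) && (o2 != o1) by [].
have c0 : lab_class T labT o0 = [set o0]%SET.
  by apply/setP => i; rewrite !inE /labT -!val_eqE /=; case: ltnP => //=; case: (val i).
have c1 : lab_class T labT o1 = [set o1]%SET.
  by apply/setP => i; rewrite !inE /labT -!val_eqE /=; case: ltnP => //=; case: (val i) => [|[]].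
have cl l : (l != o0) && (l != o1) && (l != o2) -> #|lab_class T labT l| = 0%N.
  rewrite -!val_eqE /= => /andP[/andP[l0 l1] l2]; apply/eqP; rewrite cards_eq0.
  apply/eqP/setP => i; rewrite !inE /labT; case: ltnP => i2; apply/negbTE.
    apply/negP => /= /eqP e; move: l0 l1; rewrite -e.
    by case: (val i) i2 => [|[|]].
  by apply/negP => /= /eqP e; move: l2; rewrite -e.
(* The size n-2 of the third class is read off from the total n. *)
have := @sum_card_lab_class _ T labT; rewrite cardsT card_ord.
rewrite (bigD1 o0) //= (bigD1 o1) //= (bigD1 o2) //= c0 c1 !cards1 big1 ?addn0; last first.
  by move=> l; apply: cl.
move=> c2; rewrite (bigD1 o0) //= (bigD1 o1) //= (bigD1 o2) //= c0 c1 !cards1 big1 ?addr0.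
  rewrite addrA; congr (_ + _); congr psum.
  by move: c2; rewrite !add1n => e; rewrite -[in RHS]e.
by move=> l /cl ->; rewrite psum0.
Qed.

Lemma isomorphic_T2 (Bs : {set {set 'I_n}}) (x y : 'I_n) : x != y ->
  (forall B, (B \in Bs) = (#|B| == 2%N) && ((x \in B) || (y \in B))) ->
  isomorphic Bs (T2 n).
Proof.
(* The first transposition sends x to [o0]; the second sends the image of y to [o1] and fixes
   [o0]. *)
move=> xy hB; exists (tperm x o0 * tperm (tperm x o0 y) o1)%g; set s := (_ * _)%g.
have sx : s x = o0.
  rewrite permM tpermL tpermD //.
  by rewrite -[X in _ != X](tpermL x o0) (inj_eq perm_inj) eq_sym.
have sy : s y = o1 by rewrite permM tpermL.
have two (i : 'I_n) : (i < 2)%N = (i == o0) || (i == o1).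
  by rewrite -!val_eqE /=; case: (val i) => [|[]].
have mem (B : {set 'I_n}) : (s @: B \in T2 n) = (B \in Bs).
  rewrite in_T2 ?(ltnW n3) // hB card_imset; last exact: perm_inj.
  congr (_ && _); apply/existsP/orP => [[i /andP[/imsetP[k kB ->]]]|].
    by rewrite two -sx -sy !(inj_eq perm_inj) => /orP[] /eqP <-; [left|right].
  by case=> h; [exists o0|exists o1]; rewrite -?sx -?sy imset_f // two ?sx ?sy eqxx ?orbT.
apply/setP => C; apply/imsetP/idP => [[B hBB ->]|hC]; first by rewrite mem.
have eC : C = s @: (s @^-1: C).
  apply/setP => i; apply/idP/imsetP => [iC|[k]]; last by rewrite inE => ? ->.
  by exists (s^-1%g i); rewrite ?inE permKV.
by exists (s @^-1: C); rewrite -?mem -?eC.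
Qed.

End UniformMinimal.

(** * Upper bounds on the dimension *)

Section AffineDimension.
Variables (R : realType) (n : nat).
Implicit Types (Bs : {set {set 'I_n}}) (D : {set 'I_n}).

(* The hypothesis says that D determines every vector in the orthogonal of the
   linear forms constant on the bases, which contains the direction space of the
   polytope. *)
Lemma affine_dim_base_polytope_le Bs D :
  (forall v : 'rV[R]_n,
    (forall (c : 'I_n -> R) k, (forall B, B \in Bs -> \sum_(i in B) c i = k) ->
       \sum_i v 0 i * c i = 0) ->
    (forall i, i \in D -> v 0 i = 0) -> v = 0) ->
  (affine_dim (base_polytope R Bs) <= #|D|)%N.
Proof.
move=> H; apply/bigmax_leqP => k /asboolP[x [y [hx hy free]]].
set A := \matrix_i (y i - x) in free.
have Ac u (c : 'I_n -> R) r : (forall B, B \in Bs -> \sum_(i in B) c i = r) ->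
    \sum_i (u *m A) 0 i * c i = 0.
  move=> hc.
  have cst z : base_polytope R Bs z -> \sum_i z 0 i * c i = r.
    move=> hz; apply/eqP; rewrite eq_le (base_polytope_le hz) => [/=|B /hc ->] //.
    have : \sum_i z 0 i * - c i <= - r.
      by apply: base_polytope_le hz _ => B /hc; rewrite sumrN => ->.
    by rewrite (eq_bigr (fun i => - (z 0 i * c i))) => [|i _]; rewrite ?mulrN // sumrN lerN2.
  rewrite (eq_bigr (fun i => \sum_j u 0 j * ((y j - x) 0 i * c i))); last first.
    move=> i _; rewrite mxE mulr_suml; apply: eq_bigr => j _.
    by rewrite [A _ _]mxE mulrA.
  rewrite exchange_big big1 // => j _; rewrite -mulr_sumr.
  rewrite (eq_bigr (fun i => y j 0 i * c i - x 0 i * c i)); last first.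
    by move=> i _; rewrite !mxE mulrBl.
  by rewrite sumrB !cst ?subrr ?mulr0.
(* Rows stay independent when only the columns in D are kept, since a combination vanishing on D is
   zero; hence k <= |D|. *)
pose A' := \matrix_(i < k, j < #|D|) A i (enum_val j).
have free' : row_free A'.
  apply: inj_row_free => u hu; apply: (row_free_injr free).
  rewrite /= mul0mx; apply: H => [c r hc|i iD]; first exact: Ac hc.
  move/rowP: hu => /(_ (enum_rank_in iD i)); rewrite !mxE => e.
  rewrite -[RHS]e; apply: eq_bigr => j _.
  by rewrite [A' _ _]mxE enum_rankK_in.
by rewrite -(eqP free') rank_leq_col.
Qed.

Variables (E : {set 'I_n}) (lab : 'I_n -> 'I_n) (i0 j0 : 'I_n).
Hypotheses (i0E : i0 \in E) (j0E : j0 \in E) (ij0 : lab i0 != lab j0).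
Local Notation tp := (transversal_pairs E lab).

Let ortho (v : 'rV[R]_n) := forall (c : 'I_n -> R) k,
  (forall B, B \in tp -> \sum_(i in B) c i = k) -> \sum_i v 0 i * c i = 0.

Let tp_const (c : 'I_n -> R) k :
  (forall i j, i \in E -> j \in E -> lab i != lab j -> c i + c j = k) ->
  forall B, B \in tp -> \sum_(i in B) c i = k.
Proof.
move=> h B /transversal_pairsP[i [j [iE jE ij ->]]]; rewrite sum_pair; first exact: h.
by apply: contraNneq ij => ->.
Qed.

Let ortho_loop v i : ortho v -> i \notin E -> v 0 i = 0.
Proof.
move=> hv iE; have := hv (fun j => (j == i)%:R) 0.
rewrite (bigD1 i) //= eqxx mulr1 big1 ?addr0 => [|j /negPf ->]; last by rewrite mulr0.
apply; apply: tp_const => j k jE kE _.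
have /negPf -> : j != i by apply: contraNneq iE => <-.
have /negPf -> : k != i by apply: contraNneq iE => <-.
by rewrite addr0.
Qed.

Let ortho_sum v : ortho v -> \sum_i v 0 i = 0.
Proof.
move=> hv; have := hv (fun=> 1) 2; under eq_bigr do rewrite mulr1; apply.
by apply: tp_const.
Qed.

(** Direction vectors vanish at loops and have coordinate sum 0, so the coordinate at i0 is
    determined by the others. *)
Lemma affine_dim_transversal : (affine_dim (base_polytope R tp) <= #|E|.-1)%N.
Proof.
have -> : #|E|.-1 = #|E :\ i0| by rewrite [in LHS](cardsD1 i0) i0E.
apply: affine_dim_base_polytope_le => v hv hD; apply/rowP => i; rewrite mxE.
have H j : j != i0 -> v 0 j = 0.
  by move=> ji; case: (boolP (j \in E)) => jE; [apply: hD; rewrite !inE ji|exact: ortho_loop].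
have [->|/H//] := eqVneq i i0.
by have := ortho_sum hv; rewrite (bigD1 i0) //= big1 ?addr0 // => j /H.
Qed.

(** Every base now meets the class of i0 exactly once; this second constant form also determines a
    coordinate. *)
Lemma affine_dim_transversal2 :
  (forall k, k \in E -> lab k = lab i0 \/ lab k = lab j0) ->
  (affine_dim (base_polytope R tp) <= #|E|.-2)%N.
Proof.
move=> two; have j0i0 : j0 != i0 by apply: contraNneq ij0 => ->.
have -> : #|E|.-2 = #|E :\ i0 :\ j0|.
  by rewrite [in LHS](cardsD1 i0) i0E (cardsD1 j0 (E :\ i0)) !inE j0i0 j0E.
apply: affine_dim_base_polytope_le => v hv hD.
have H j : j != i0 -> j != j0 -> v 0 j = 0.
  move=> ji jj; case: (boolP (j \in E)) => jE; last exact: ortho_loop.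
  by apply: hD; rewrite !inE ji jj.
have vi0 : v 0 i0 = 0.
  have := hv (fun i => (lab i == lab i0)%:R) 1.
  rewrite (bigD1 i0) //= eqxx mulr1 big1 ?addr0 => [|j ji]; last first.
    have [->|jj] := eqVneq j j0; last by rewrite H ?mul0r.
    by rewrite eq_sym (negPf ij0) mulr0.
  apply; apply: tp_const => i j iE jE ij.
  have [ei|ei] := two _ iE; have [ej|ej] := two _ jE; rewrite ei ej ?eqxx in ij *;
    rewrite // [lab j0 == _]eq_sym (negPf ij0) ?addr0 ?add0r //.
apply/rowP => i; rewrite mxE; have [->//|ii] := eqVneq i i0.
have [->|/H->//] := eqVneq i j0.
have := ortho_sum hv; rewrite (bigD1 j0) //= big1 ?addr0 // => j jj.
by have [->|/H->//] := eqVneq j i0.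
Qed.

End AffineDimension.

(** * Coefficient bounds and Ehrhart positivity *)

Theorem theorem1p2 (R : realType) (n : nat) :
  (forall M : matroid [set: 'I_n]%SET,
     matroid_rank M = 2%N -> connected_matroid M ->
     [/\ coef_le (ehr (base_polytope R (T2 n))) (ehr (base_polytope R M)),
         coef_le (ehr (base_polytope R M)) (ehr (base_polytope R (U2 n))) &
         ~ isomorphic M (T2 n) -> bases M <> U2 n ->
         forall j : nat, (1 <= j <= n.-1)%N ->
           (ehr (base_polytope R (T2 n)))`_j < (ehr (base_polytope R M))`_j /\
           (ehr (base_polytope R M))`_j < (ehr (base_polytope R (U2 n)))`_j]) /\
  (forall N : matroid [set: 'I_n]%SET,
     matroid_rank N = 2%N -> ehrhart_positive (base_polytope R N)).
Proof.
split=> [M M2 Mc|N N2]; last first.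
  have [E [lab [i0 [j0 [-> i0E j0E ij0]]]]] := rank2_labels N2.
  have E2 : (1 < #|E|)%N.
    by apply/card_gt1P; exists i0, j0; split => //; apply: contraNneq ij0 => ->.
  (* A third class gives positivity up to degree |E|-1; with two classes the dimension is at most
     |E|-2, where [ehr_gt0] suffices. *)
  move=> j; case: (boolP [exists k in E, (lab k != lab i0) && (lab k != lab j0)]).
    move=> /exists_inP[k kE /andP[ki kj]].
    move=> /leq_trans/(_ (affine_dim_transversal R lab i0E)).
    rewrite leq_eqVlt => /orP[/eqP ->|]; last exact: (ehr_gt0 R i0E j0E ij0).
    by apply: (ehr_gt0_top R i0E j0E ij0 kE ki kj); rewrite leqnn andbT -ltnS prednK // ltnW.
  rewrite negb_exists_in => /forall_inP two.
  have two' k : k \in E -> lab k = lab i0 \/ lab k = lab j0.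
    by move=> /two; rewrite negb_and !negbK => /orP[] /eqP; [left|right].
  move=> /leq_trans/(_ (affine_dim_transversal2 R i0E j0E ij0 two')) hj.
  by apply: (ehr_gt0 R i0E j0E ij0); apply: leq_ltn_trans hj _; move: E2; case: #|E| => [|[|m]].
have [E [lab [i0 [j0 [ME i0E j0E ij0]]]]] := rank2_labels M2.
have ET := connected_loopless ME Mc i0E.
have [k0 [ki0 kj0]] := connected_third ME Mc i0E j0E ij0.
have k0E : k0 \in E by rewrite ET inE.
have cE : #|E| = n by rewrite ET cardsT card_ord.
have n3 : (2 < n)%N.
  rewrite -{1}cE; apply/card_gt2P; exists i0, j0, k0; split => //; split.
  - by apply: contraNneq ij0 => ->.
  - by apply: contraNneq kj0 => ->.
  - by apply: contraNneq ki0 => ->.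
split=> [j|j|niso nunif j hj]; rewrite ?coefB ?subr_ge0 ME.
- rewrite coef_ehr_T2 //; have := ehr_ge_minimal R i0E j0E ij0 k0E ki0 kj0 j.
  by rewrite cE.
- rewrite coef_ehr_U2 ?(ltnW n3) //; have := ehr_le_uniform R i0E j0E ij0 j.
  by rewrite cE.
rewrite coef_ehr_T2 // coef_ehr_U2 ?(ltnW n3) //; split.
  have := @ehr_gt_minimal R _ _ _ _ _ i0E j0E ij0 _ k0E ki0 kj0 j.
  rewrite cE; apply => // l l' cl cl' ll'.
  (* Otherwise all elements outside the two singleton classes {x} and {y} are parallel, so the bases
     are the pairs meeting {x, y} and M is minimal. *)
  have [//|no] := pselect (exists k k', [/\ uniq [:: l; l'; k; k'],
    (0 < #|lab_class E lab k|)%N & (0 < #|lab_class E lab k'|)%N]).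
  case: niso.
  have /eqP/cards1P[x hx] := cl; have /eqP/cards1P[y hy] := cl'.
  have labx z : (lab z == l) = (z == x).
    by have /setP/(_ z) := hx; rewrite !inE ET inE.
  have laby z : (lab z == l') = (z == y).
    by have /setP/(_ z) := hy; rewrite !inE ET inE.
  have xy : x != y.
    by rewrite -laby; have := labx x; rewrite eqxx => /eqP ->.
  have cls0 z : (0 < #|lab_class E lab (lab z)|)%N by apply: lab_class_gt0; rewrite ET inE.
  have rest z w : z != x -> z != y -> w != x -> w != y -> lab z = lab w.
    rewrite -!labx -!laby => zl zl' wl wl'; apply/eqP/negPn/negP => zw; apply: no.
    exists (lab z), (lab w); split => //.
    by rewrite /= !inE !negb_or ll' zw !(eq_sym l) !(eq_sym l') zl zl' wl wl'.
  apply: (@isomorphic_T2 _ n3 _ x y) => // B; rewrite ME.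
  apply/transversal_pairsP/andP.
    move=> [z [w [_ _ zw ->]]]; rewrite cards2 !inE.
    have -> : z != w by apply: contraNneq zw => ->.
    split=> //; apply: contraNT zw; rewrite !negb_or ![x == _]eq_sym ![y == _]eq_sym.
    by move=> /andP[/andP[zx wx] /andP[zy wy]]; apply/eqP; apply: rest.
  move=> [/cards2P[z [w [zw ->]]] h]; exists z, w; split; rewrite ?ET ?inE //.
  move: h; rewrite !inE => /orP[]/orP[]/eqP e; subst.
  - by have := labx z; rewrite eqxx => /eqP ->; rewrite eq_sym labx eq_sym.
  - by have := labx w; rewrite eqxx => /eqP ->; rewrite labx.
  - by have := laby z; rewrite eqxx => /eqP ->; rewrite eq_sym laby eq_sym.
  - by have := laby w; rewrite eqxx => /eqP ->; rewrite laby.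
(* Either two elements are parallel, which makes the bound strict, or all labels differ and M is
   uniform. *)
have [[x [y [xy lxy]]]|inj] := pselect (exists x y, x != y /\ lab x = lab y).
  have := @ehr_lt_uniform R _ _ _ _ _ i0E j0E ij0 j x y; rewrite cE; apply => //;
    by rewrite ET inE.
case: nunif; rewrite ME U2_transversal; apply/setP => B.
apply/transversal_pairsP/transversal_pairsP => -[x [y [_ _ xy ->]]]; exists x, y.
  by split; rewrite ?inE //; apply: contraNneq xy => ->.
split; rewrite ?ET ?inE //; apply/eqP => e; apply: inj.
by exists x, y.
Qed.
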